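(* In the standing setting described in the context, let $\mu\in[1,\infty)$, and for $\alpha>0$ let $(R_\alpha,U_\alpha,e_\alpha,S_\alpha)$ be the IGR traveling wave normalized so that $R_\alpha(0)=R_s$. Let $R_0(\xi)=R_-$ for $\xi<0$ and $R_0(\xi)=R_+$ for $\xi>0$. Then $R_\alpha$ converges to $R_0$ in $L^\mu(\mathbb R)$ as $\alpha\to0^+$ at rate $\alpha^{1/(2\mu)}$, i.e. $$\|R_\alpha-R_0\|_{L^\mu(\mathbb R)}\le C\alpha^{1/(2\mu)},$$ where $C$ is independent of $\alpha$. An analogous statement holds for $U_\alpha$ (with limit equal to $U_-$ for $\xi<0$ and $U_+$ for $\xi>0$), $e_\alpha$ (with limit equal to $e_-$ for $\xi<0$ and $e_+$ for $\xi>0$) and $S_\alpha$ (with limit $0$).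
   Context: Standing setting (all data below are independent of $\alpha$; $\alpha>0$ is a varying parameter). Fix a physical equation of state $\tilde p:(0,\infty)\times\mathbb R\to\mathbb R$, $(\rho,e)\mapsto\tilde p(\rho,e)$, of class $C^2$, real numbers $c,m,q,k$ with $m\neq0$, and end states $R_\pm>0$, $U_\pm,\mathcal E_\pm\in\mathbb R$. Put $e_\pm=\mathcal E_\pm/R_\pm-\frac12U_\pm^2$ and assume the Rankine–Hugoniot relations $R_\pm(U_\pm-c)=m$, $mU_\pm+\tilde p(R_\pm,e_\pm)=q$, $(\mathcal E_\pm+\tilde p(R_\pm,e_\pm))U_\pm-c\,\mathcal E_\pm=k$. For $R>0$ define $$e(R)=e_0+\frac{A}{R}+\frac{m^2}{2R^2},\quad e_0=\frac{k-qc+\frac m2c^2}{m},\quad A=mc-q,$$ the reduced pressure $p(R)=\tilde p(R,e(R))$, and $\mathcal S(R)=q-mc-\frac{m^2}{R}-p(R)$. (Then $e(R_\pm)=e_\pm$ and $\mathcal S(R_\pm)=0$.) Primes denote $d/dR$, dots denote $d/d\xi$. Assume: (1) $R_-<R_+$; (2) Lax inequalities: $U_--\sqrt{p'(R_-)}>c>U_+-\sqrt{p'(R_+)}$ (with $p'(R_\pm)\ge0$); equivalently $m>0$, $\frac{m^2}{R_-^2}-p'(R_-)>0$ and $\frac{m^2}{R_+^2}-p'(R_+)<0$; (3) $p\in C^2((0,\infty))$, and one of the following convexity criteria holds along $(\rho,e)=(R,e(R))$ for $R\in[R_-,R_+]$: (A) the matrix $\begin{pmatrix}\tilde p_{\rho\rho}+\frac{m^2}{R^4}\tilde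 p_e&\tilde p_{\rho e}-\frac1R\tilde p_e\\ \tilde p_{\rho e}-\frac1R\tilde p_e&\tilde p_{ee}\end{pmatrix}$ is positive semidefinite; or (B) $\tilde p_{\rho\rho}\ge0$, $\tilde p_{ee}\ge0$, $\tilde p_e\ge0$, $\tilde p_{\rho e}\ge\frac1R\tilde p_e$, $e'(R)\ge0$. In particular $p''(R)\ge0$, and this inequality is assumed for all $R>0$; (4) $p''$ is Lipschitz in a neighborhood of $R_s$, where the sonic density $R_s\in(R_-,R_+)$ is the unique zero of $\mathcal S'$ in $(0,\infty)$. For $\alpha>0$, $R_\alpha$ is the unique nondecreasing function $R:\mathbb R\to[R_-,R_+]$ in $W^{1,2}_{\mathrm{loc}}(\mathbb R)$ with $R(\xi)\to R_\pm$ as $\xi\to\pm\infty$, normalized by $R(0)=R_s$, such that for every $\varphi\in C_c^\infty(\mathbb R)$ $$\int_{\mathbb R}\alpha\frac{\mathcal S'(R)}{R}\dot R\,\dot\varphi\,d\xi+\int_{\mathbb R}\Big(\frac{\mathcal S(R)}{R}-2\alpha\frac{m^2}{R^4}\dot R^2\Big)\varphi\,d\xi=0,$$ and $U_\alpha=c+m/R_\alpha$, $e_\alpha=e(R_\alpha)$, $S_\alpha=\mathcal S(R_\alpha)$. *)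

(* Defs.v *)
From HB Require Import structures.
From mathcomp Require Import all_boot all_order all_algebra.
From mathcomp Require Import all_classical all_reals all_analysis.
Set Implicit Arguments.
Unset Strict Implicit.
Unset Printing Implicit Defensive.
Import Order.TTheory GRing.Theory Num.Theory.
Import numFieldNormedType.Exports.
Local Open Scope classical_set_scope.
Local Open Scope ring_scope.

Section Defs.
Context {R : realType}.

Notation mu := (@lebesgue_measure R).

(** ** Regularity of functions of one and two real variables *)

Definition d_rho (f : R -> R -> R) : R -> R -> R :=
  fun rho e => derive1 (f^~ e) rho.

Definition d_e (f : R -> R -> R) : R -> R -> R :=
  fun rho e => derive1 (f rho) e.

Definition C1_on (D : set (R * R)) (f : R -> R -> R) : Prop :=
  forall x, D x ->
    [/\ derivable (f^~ x.2) x.1 1,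
        derivable (f x.1) x.2 1,
        {for x, continuous (fun y : R * R => d_rho f y.1 y.2)} &
        {for x, continuous (fun y : R * R => d_e f y.1 y.2)}].

Definition C2_on (D : set (R * R)) (f : R -> R -> R) : Prop :=
  [/\ C1_on D f, C1_on D (d_rho f) & C1_on D (d_e f)].

Definition C2_on1 (D : set R) (f : R -> R) : Prop :=
  forall x, D x ->
    [/\ derivable f x 1, derivable (derive1 f) x 1 &
        {for x, continuous (derive1n 2 f)}].

(** ** Positive semidefinite matrices *)

Definition psdmx n (M : 'M[R]_n) : Prop :=
  M^T = M /\ forall v : 'rV[R]_n, 0 <= (v *m M *m v^T) 0 0.

(** ** Reduced quantities along the Rankine-Hugoniot curve *)

Definition energy (c m q k r : R) : R :=
  (k - q * c + m / 2 * c ^+ 2) / m + (m * c - q) / r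
    + m ^+ 2 / (2 * r ^+ 2).

Definition reduced_pressure (pt : R -> R -> R) (c m q k r : R) : R :=
  pt r (energy c m q k r).

Definition calS (pt : R -> R -> R) (c m q k r : R) : R :=
  q - m * c - m ^+ 2 / r - reduced_pressure pt c m q k r.

Definition rankine_hugoniot (pt : R -> R -> R) (c m q k rho u E : R) : Prop :=
  let e := E / rho - u ^+ 2 / 2 in
  [/\ rho * (u - c) = m,
      m * u + pt rho e = q &
      (E + pt rho e) * u - c * E = k].

Definition convexity_A (pt : R -> R -> R) (c m q k rm rp : R) : Prop :=
  forall r, r \in `[rm, rp] ->
    let e := energy c m q k r in
    let a := d_rho (d_rho pt) r e + m ^+ 2 / r ^+ 4 * d_e pt r e in
    let b := d_e (d_rho pt) r e - r^-1 * d_e pt r e in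
    let d := d_e (d_e pt) r e in
    psdmx (block_mx a%:M b%:M b%:M d%:M : 'M[R]_(1 + 1)).

Definition convexity_B (pt : R -> R -> R) (c m q k rm rp : R) : Prop :=
  forall r, r \in `[rm, rp] ->
    let e := energy c m q k r in
    [/\ 0 <= d_rho (d_rho pt) r e,
        0 <= d_e (d_e pt) r e,
        0 <= d_e pt r e,
        r^-1 * d_e pt r e <= d_e (d_rho pt) r e &
        0 <= derive1 (energy c m q k) r].

(** ** Weak derivatives on the line *)

Definition test_function (phi : R -> R) : Prop :=
  (forall n x, derivable (derive1n n phi) x 1) /\
  compact (closure [set x | phi x != 0]).

Definition L2loc (f : R -> R) : Prop :=
  measurable_fun setT f /\ locally_integrable setT (fun x => f x ^+ 2).

Definition weak_derivative (f g : R -> R) : Prop :=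
  forall phi, test_function phi ->
    \int[mu]_x (f x * derive1 phi x) = - \int[mu]_x (g x * phi x).

(** [dr] is a representative of the weak derivative of [r]; since such
    representatives agree almost everywhere, the choice does not affect the
    integrals. *)
Definition igr_wave (m rm rp rs : R) (S : R -> R) (alpha : R) (r : R -> R)
    : Prop :=
  [/\ {homo r : x y / x <= y},
      forall xi, r xi \in `[rm, rp],
      r xi @[xi --> -oo] --> rm /\ r xi @[xi --> +oo] --> rp,
      r 0 = rs &
      exists dr : R -> R,
        [/\ L2loc r, L2loc dr, weak_derivative r dr &
            forall phi, test_function phi ->
              \int[mu]_xi
                 (alpha * (derive1 S (r xi) / r xi) * dr xi * derive1 phi xi)
              + \int[mu]_xi
                 ((S (r xi) / r xi
                   - 2 * alpha * (m ^+ 2 / r xi ^+ 4) * dr xi ^+ 2) * phi xi)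
              = 0]].

(** ** Convergence rates *)

(** The value at [0] is immaterial. *)
Definition step (a b : R) (xi : R) : R := if xi < 0 then a else b.

Definition Lp_rate (p : R) (f : R -> R -> R) (f0 : R -> R) : Prop :=
  exists C : R, forall alpha : R, 0 < alpha ->
    (Lnorm mu p%:E (fun xi => (f alpha xi - f0 xi)%:E)
      <= (C * alpha `^ (2 * p)^-1)%:E)%E.

End Defs.

(* Main.v *)
(** The density [r] solves, weakly,
    [(alpha S'(r) r' / r)' = S(r) / r - 2 alpha m^2 r'^2 / r^4].  Testing with
    smoothed indicators of intervals turns this into an integral identity, so
    that [r] is a classical solution wherever [S'(r) <> 0].  There
    [u := (log r)'] satisfies [alpha u' S'(r) >= S(r) / r], because
    [S'' <= - 2 m^2 / r^3]; on the left of the sonic point concavity gives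
    [S(r) >= S'(r) (r - rm)], hence [alpha u' >= (r - rm) / r].  Therefore
    [alpha u^2 - ((r - rm) / rp)^2] is nondecreasing, and letting the argument
    tend to [-oo] gives [sqrt alpha * u >= (r - rm) / rp], that is,
    [r - rm <= C sqrt alpha * r'].  Integrating, and arguing symmetrically on
    the right, the L^1 distance to the step is O(sqrt alpha); the L^p rates
    follow because all the quantities are bounded and Lipschitz in [r]. *)
Require Import Defs.
From HB Require Import structures.
From mathcomp Require Import all_boot all_order all_algebra.
From mathcomp Require Import all_classical all_reals all_analysis.
From mathcomp Require Import measurable_realfun ring lra.
Set Implicit Arguments.
Unset Strict Implicit.
Unset Printing Implicit Defensive.
Import Order.TTheory GRing.Theory Num.Theory.
Import numFieldNormedType.Exports.
Local Open Scope classical_set_scope.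
Local Open Scope ring_scope.

(** * Smooth transition functions *)

Section NDiff.
Context {R : realType}.
Implicit Types (f g : R -> R) (n : nat) (x y : R).

(** The obstacle is the sonic value: [derive1 S rs = 0], so the equation degenerates where [r = rs]
    and gives no classical derivative there. It suffices that this level be attained only at 0. A
    plateau at [rs] is impossible, because the flux would vanish on it while its derivative would be
    [S rs / rs > 0]. Each open half-line is then treated separately, and only the continuity of [r]
    is carried across 0. The inequality for [u] rests on an exact cancellation. With
    [w = alpha S'(r) u] the equation reads [w' = S(r) / r - 2 alpha m^2 u^2 / r^2], while the
    product rule gives [w' = alpha S'(r) u' + alpha r S''(r) u^2]. The terms quadratic in [u]
    combine into a multiple of [- 2 m^2 / r^3 - S''(r) = p''(r)], so their sign is the convexity of
    the reduced pressure. At infinity the only information used is [alpha u^2 >= 0] and the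
    convergence of [r]; the speed [u] itself is not shown to decay. *)

Fixpoint ndiff n f : Prop :=
  if n is n'.+1 then (forall x, derivable f x 1) /\ ndiff n' (derive1 f)
  else True.

(** [ndiff] differentiates the function first and recurses on the result, a form in which closure
    under products and quotients follows by induction on [n]. This lemma returns to the iterated
    derivatives that [test_function] asks for. *)
Lemma smooth_ndiff f :
  (forall n, ndiff n f) -> forall n x, derivable (derive1n n f) x 1.
Proof.
move=> sf n; have : forall k, ndiff k (derive1n n f).
  elim: n => [//|n IH] k; rewrite derive1nS.
  by have [_ ] := IH k.+1.
by move=> /(_ 1%N)[].
Qed.

Lemma is_derive_derive1 f (df : R) x : is_derive x 1 f df -> derive1 f x = df.
Proof. by move=> h; rewrite derive1E derive_val. Qed.

Lemma derivable_is_derive f x : derivable f x 1 -> is_derive x 1 f (derive1 f x).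
Proof. by move=> fx; apply: DeriveDef => //; rewrite derive1E. Qed.

Lemma ndiff_step n f (df : R -> R) :
  (forall x, is_derive x 1 f (df x)) -> ndiff n df -> ndiff n.+1 f.
Proof.
move=> h ndf; split; first by move=> x; exact: (@ex_derive _ _ _ _ _ _ _ (h x)).
by rewrite (_ : derive1 f = df)//; apply/funext => x; exact: is_derive_derive1.
Qed.

Lemma ndiffW n f : ndiff n.+1 f -> ndiff n f.
Proof. by elim: n f => [//|n IH] f [df /IH]. Qed.

Lemma ndiff_cst n (c : R) : ndiff n (fun=> c).
Proof.
elim: n c => [//|n IH] c; apply: (ndiff_step (df := fun=> 0)) => // x.
Qed.

Lemma ndiffD n f g : ndiff n f -> ndiff n g -> ndiff n (fun x => f x + g x).
Proof.
elim: n f g => [//|n IH] f g [df nf] [dg ng].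
apply: (ndiff_step (df := fun x => derive1 f x + derive1 g x)); last exact: IH.
by move=> x; apply: is_deriveD; exact: derivable_is_derive.
Qed.

Lemma ndiffM n f g : ndiff n f -> ndiff n g -> ndiff n (fun x => f x * g x).
Proof.
elim: n f g => [//|n IH] f g nf ng.
have [df ndf] := nf; have [dg ndg] := ng.
apply: (ndiff_step (df := fun x => f x * derive1 g x + g x * derive1 f x)).
  by move=> x; apply: is_deriveM; exact: derivable_is_derive.
by apply: ndiffD; apply: IH => //; exact: ndiffW.
Qed.

Lemma ndiffN n f : ndiff n f -> ndiff n (fun x => - f x).
Proof.
move=> nf; rewrite (_ : (fun x => _) = fun x => (-1) * f x).
  exact: ndiffM (ndiff_cst _ _) nf.
by apply/funext => x; rewrite mulN1r.
Qed.

Lemma ndiff_affine n f (a b : R) : ndiff n f -> ndiff n (fun x => f (a * x + b)).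
Proof.
elim: n f => [//|n IH] f [df nf].
apply: (ndiff_step (df := fun x => a * derive1 f (a * x + b))); last first.
  by apply: ndiffM; [exact: ndiff_cst|exact: IH].
move=> x.
have ha : is_derive x 1 (fun y => a * y + b) a.
  have := is_deriveD (is_deriveM (is_derive_cst a x 1) (is_derive_id x 1)) (is_derive_cst b x 1).
  move=> H; refine (is_derive_eq (df := a) H _).
  by rewrite /cst /GRing.scale/= mulr1 mulr0 !addr0.
have := @is_derive1_comp _ f (fun y => a * y + b) x _ _ (derivable_is_derive (df _)) ha.
by rewrite mulrC.
Qed.

(** The derivative of [1 / f] is a product of [f'] and copies of [1 / f] itself, so [f] stays fixed
    in the induction. *)
Lemma ndiffV n f : (forall x, 0 < f x) -> ndiff n f -> ndiff n (fun x => (f x)^-1).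
Proof.
move=> f0; elim: n => [//|n IH] nf; have [df ndf] := nf.
have IHf := IH (ndiffW nf).
apply: (ndiff_step (df := fun x => - derive1 f x * ((f x)^-1 * (f x)^-1))).
  move=> x; have fx0 : f x != 0 by rewrite gt_eqF.
  have := is_deriveV fx0 (derivable_is_derive (df x)).
  move=> H; refine (is_derive_eq H _).
  by rewrite /GRing.scale/= expr2 invfM mulrC mulrN mulNr.
apply: ndiffM; first exact: ndiffN.
exact: ndiffM.
Qed.

(** The powers of [1 / x] make the span of this family stable under differentiation, so smoothness
    at 0 needs only a first derivative for each [n]. *)
Definition flat n (x : R) := if 0 < x then x^-1 ^+ n * expR (- x^-1) else 0.

Lemma flat_ge0 n x : 0 <= flat n x.
Proof.
by rewrite /flat; case: ifP => // x0; rewrite mulr_ge0// ?expR_ge0// exprn_ge0// invr_ge0 ltW.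
Qed.

(** One term of the exponential series at [1 / x], of order [n + 1], already beats [x^-n] by a
    factor [x]. This yields continuity at 0 and, used for [n + 1], differentiability there. *)
Lemma flat_le n x : 0 <= x -> flat n x <= n.+1`!%:R * x.
Proof.
rewrite /flat => x0; case: ifPn => [{}x0|_]; last by rewrite mulr_ge0.
have y0 : 0 < x^-1 by rewrite invr_gt0.
have := expR_ge1Dxn n (ltW y0).
rewrite expRN ler_pdivrMr ?expR_gt0// => h.
have : x^-1 ^+ n.+1 / n.+1`!%:R <= expR x^-1.
  by apply: le_trans h; rewrite lerDr.
rewrite ler_pdivrMr ?ltr0n ?fact_gt0// exprSr => h'.
have : x^-1 ^+ n * x^-1 * x <= expR x^-1 * n.+1`!%:R * x by rewrite ler_pM2r.
rewrite mulfVK ?gt_eqF// => /le_trans; apply.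
by rewrite le_eqVlt; apply/orP; left; apply/eqP; ring.
Qed.

Lemma is_derive_flat n x :
  is_derive x 1 (flat n) (- n%:R * flat n.+1 x + flat n.+2 x).
Proof.
have [x0|x0|->] := ltgtP x 0.
- rewrite /flat (ltNge 0) (ltW x0)/= mulr0 addr0.
  apply: (@near_eq_is_derive _ _ _ (fun=> 0)).
    near=> y; rewrite /flat ltNge; case: ltP => // y0.
    suff : y < 0 by lra.
    by near: y; exact: lt_nbhsl.
- rewrite /flat x0.
  have xn0 : x != 0 by rewrite gt_eqF.
  apply: (@near_eq_is_derive _ _ _ (fun y => y^-1 ^+ n * expR (- y^-1))).
    near=> y; suff -> : 0 < y by [].
    by near: y; exact: lt_nbhsr.
  have dV : is_derive x 1 (fun y : R => y^-1) (- x ^- 2).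
    have := @is_deriveV _ id x 1 1 xn0 (is_derive_id x 1).
    by move=> H; refine (is_derive_eq H _); rewrite /GRing.scale/= mulr1.
  have dX : is_derive x 1 (fun y : R => y^-1 ^+ n) (n%:R * x^-1 ^+ n.-1 * (- x ^- 2)).
    have := @is_deriveX _ _ _ n x 1 _ dV.
    by rewrite exprfctE.
  have dN : is_derive x 1 (fun y : R => - y^-1) (- - x ^- 2).
    exact: is_deriveN.
  have dE := @is_derive1_comp _ expR (fun y : R => - y^-1) x _ _ (is_derive_expR _) dN.
  have := is_deriveM dX dE.
  move=> H; refine (is_derive_eq H _); rewrite /GRing.scale/= opprK -exprVn.
  case: n {dX dE H} => [|n] /=; rewrite ?expr0 ?exprS; ring.
- suff h : h^-1 *: ((flat n \o shift 0) (h *: 1) - flat n 0) @[h --> 0^'] --> (0 : R).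
    rewrite {2 3}/flat ltxx mulr0 addr0; apply: DeriveDef.
      by apply/cvg_ex; exists 0.
    exact: cvg_lim.
  apply/cvgrPdist_lt => e e0; near=> h.
  rewrite sub0r normrN /= /shift/= addr0 /GRing.scale/= mulr1.
  rewrite {2}/flat ltxx subr0.
  have [h0|h0] := ltP 0 h; last by rewrite /flat (ltNge 0 h) h0/= mulr0 normr0.
  (* Dividing by [h] raises the exponent by one, so the difference quotient at 0 is again a member
     of the family. *)
  rewrite (_ : _ * _ = flat n.+1 h); last by rewrite /flat h0 mulrA -exprS.
  rewrite ger0_norm ?flat_ge0//.
  apply: le_lt_trans (flat_le _ (ltW h0)) _.
  rewrite mulrC -ltr_pdivlMr ?ltr0n ?fact_gt0//.
  rewrite -(gtr0_norm h0).
  near: h; apply: dnbhs0_lt.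
  by rewrite divr_gt0// ltr0n fact_gt0.
Unshelve. all: by end_near. Qed.

Lemma ndiff_flat k n : ndiff k (flat n).
Proof.
elim: k n => [//|k IH] n.
apply: (ndiff_step (is_derive_flat n)).
by apply: ndiffD => //; apply: ndiffM => //; exact: ndiff_cst.
Qed.

Definition smooth_step (x : R) := flat 0 x / (flat 0 x + flat 0 (1 - x)).

Lemma flat_gt0 n x : 0 < x -> 0 < flat n x.
Proof.
by move=> x0; rewrite /flat x0 mulr_gt0 ?expR_gt0// exprn_gt0// invr_gt0.
Qed.

Let den_gt0 x : 0 < flat 0 x + flat 0 (1 - x).
Proof.
have [x0|x0] := ltP 0 x; first by rewrite ltr_wpDr// ?flat_ge0// flat_gt0.
by rewrite ltr_wpDl// ?flat_ge0// flat_gt0//; lra.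
Qed.

Lemma ndiff_smooth_step n : ndiff n smooth_step.
Proof.
apply: ndiffM; first exact: ndiff_flat.
apply: ndiffV => //; apply: ndiffD; first exact: ndiff_flat.
have := @ndiff_affine n (flat 0) (-1) 1 (ndiff_flat _ _).
by under [X in ndiff _ X]funext => x do rewrite mulN1r addrC.
Qed.

Lemma smooth_step0 x : x <= 0 -> smooth_step x = 0.
Proof. by move=> x0; rewrite /smooth_step /flat ltNge x0 mul0r. Qed.

Lemma smooth_step1 x : 1 <= x -> smooth_step x = 1.
Proof.
move=> x1; rewrite /smooth_step (_ : flat 0 (1 - x) = 0).
  by rewrite addr0 divff// gt_eqF// flat_gt0//; lra.
by rewrite /flat subr_gt0 ltNge x1.
Qed.

Lemma smooth_step_ge0 x : 0 <= smooth_step x.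
Proof. by rewrite divr_ge0 ?flat_ge0// ltW. Qed.

Lemma smooth_step_le1 x : smooth_step x <= 1.
Proof. by rewrite ler_pdivrMr// mul1r lerDl flat_ge0. Qed.

Lemma derive1_smooth_step_out x : x < 0 \/ 1 < x -> derive1 smooth_step x = 0.
Proof.
move=> h; have [c xc] : exists c : R, \near x, c = smooth_step x.
  case: h => h.
    exists 0; near=> y; rewrite smooth_step0//.
    by apply: ltW; near: y; exact: lt_nbhsl.
  exists 1; near=> y; rewrite smooth_step1//.
  by apply: ltW; near: y; exact: lt_nbhsr.
apply: is_derive_derive1; apply: (@near_eq_is_derive _ _ _ (fun=> c)) => //.
Unshelve. all: by end_near. Qed.

Lemma derive1_smooth_step_bounded : exists M : R, 0 < M /\ forall x, `|derive1 smooth_step x| <= M.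
Proof.
have [d1 [d2 _]] := ndiff_smooth_step 2.
have c : {within `[0, 1], continuous (fun x => `|derive1 smooth_step x|)}.
  apply: continuous_subspaceT => x; apply: continuous_comp; last exact: norm_continuous.
  by apply: differentiable_continuous; apply/derivable1_diffP.
have [z _ zmax] := EVT_max (@ler01 R) c.
exists (`|derive1 smooth_step z| + 1); split; first by rewrite ltr_wpDl.
move=> x; have [x0|x0] := ltP x 0.
  by rewrite derive1_smooth_step_out ?normr0 ?addr_ge0//; left.
have [x1|x1] := ltP 1 x.
  by rewrite derive1_smooth_step_out ?normr0 ?addr_ge0//; right.
by rewrite ler_wpDr// zmax// in_itv/= x0.
Qed.
End NDiff.

(** * Mollified indicators *)

Section WeakFTC.
Context {R : realType}.
Notation mu := (@lebesgue_measure R).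
Implicit Types (f g k : R -> R) (a b x y t e : R).

Lemma integrable_EFinZl (D : set R) (c : R) f : measurable D ->
  mu.-integrable D (EFin \o f) -> mu.-integrable D (EFin \o (fun t => c * f t)).
Proof. by move=> mD fi; exact: (@integrableZl _ _ _ mu D mD c _ fi). Qed.

Lemma integrable_EFinB (D : set R) f g : measurable D ->
  mu.-integrable D (EFin \o f) -> mu.-integrable D (EFin \o g) ->
  mu.-integrable D (EFin \o (fun t => f t - g t)).
Proof. by move=> mD fi gi; exact: (@integrableB _ _ _ mu D mD _ _ fi gi). Qed.

Lemma locint_integrable f a b : locally_integrable setT f ->
  mu.-integrable `[a, b] (EFin \o f).
Proof.
move=> [mf _ lf]; apply/integrableP; split.
  by apply/measurable_EFinP; exact: measurable_funS mf.
by apply: lf => //; exact: segment_compact.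
Qed.

Lemma locint_integrableM f k a b (M : R) : locally_integrable setT f ->
  measurable_fun setT k -> (forall t, `|k t| <= M) ->
  (forall t, t \notin `[a, b] -> k t = 0) ->
  mu.-integrable setT (EFin \o (fun t => f t * k t)).
Proof.
move=> lf mk kM k0; have [mf _ _] := lf.
have := locint_integrable a b lf => /(integrable_mkcond _ _).1 - /(_ (measurable_itv _)) H.
have /= := integrableZl measurableT M H.
apply: le_integrable => //.
  by apply/measurable_EFinP; exact: measurable_funM.
move=> t _ /=; rewrite restrict_EFin /= lee_fin patchE.
case: ifPn => tab; last first.
  by rewrite k0 ?mulr0 ?normr0//; apply: contra tab; rewrite inE.
rewrite !normrM mulrC ler_wpM2r//; exact: le_trans (kM t) (ler_norm _).
Qed.

(** A one-sided mollifier: unit mass, supported in [[x, x + e]], of size at most [M / e] with [M] a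
    bound for the derivative of [smooth_step]. *)
Definition bump_at x e t : R := e^-1 * derive1 smooth_step ((t - x) / e).

Lemma is_derive_smooth_step x e t :
  is_derive t 1 (fun t => smooth_step ((t - x) / e)) (bump_at x e t).
Proof.
have [d1 _] := @ndiff_smooth_step R 1.
have ha : is_derive t 1 (fun t => (t - x) / e) e^-1.
  have H := is_deriveM (is_deriveB (is_derive_id t 1) (is_derive_cst x t 1)) (is_derive_cst e^-1 t 1).
  refine (is_derive_eq H _).
  by rewrite /cst /GRing.scale/= mulr0 add0r subr0 mulr1.
have := @is_derive1_comp _ smooth_step (fun t => (t - x) / e) t _ _ (derivable_is_derive (d1 _)) ha.
by rewrite mulrC.
Qed.

Lemma continuous_bump x e : continuous (bump_at x e).
Proof.
have [_ [d2 _]] := @ndiff_smooth_step R 2.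
move=> t; apply: cvgM; first exact: cvg_cst.
apply: continuous_comp.
  by apply: cvgM; [apply: cvgB; [exact: cvg_id|exact: cvg_cst]|exact: cvg_cst].
by apply: differentiable_continuous; apply/derivable1_diffP.
Qed.

Lemma measurable_bump x e : measurable_fun setT (bump_at x e).
Proof. by apply: continuous_measurable_fun; exact: continuous_bump. Qed.

Lemma bump_out x e t : 0 < e -> t \notin `[x, x + e] -> bump_at x e t = 0.
Proof.
move=> e0; rewrite in_itv/= negb_and -!ltNge => /orP h.
rewrite /bump_at derive1_smooth_step_out ?mulr0//.
case: h => h; [left|right].
  by rewrite pmulr_llt0 ?invr_gt0// subr_lt0.
by rewrite ltr_pdivlMr// mul1r ltrBrDl.
Qed.

Lemma integral_bump x e : 0 < e -> \int[mu]_(t in `[x, x + e]) bump_at x e t = 1.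
Proof.
move=> e0; have xe : x < x + e by rewrite ltrDl.
rewrite /Rintegral (@continuous_FTC2 _ _ (fun t => smooth_step ((t - x) / e)))//.
  rewrite -EFinB/= subrr mul0r (_ : x + e - x = e); last by ring.
  rewrite divff ?gt_eqF//.
  by rewrite smooth_step1// smooth_step0// subr0.
- by apply: continuous_subspaceT; exact: continuous_bump.
- have c t : {for t, continuous (fun t => smooth_step ((t - x) / e))}.
    apply: differentiable_continuous; apply/derivable1_diffP.
    exact: (@ex_derive _ _ _ _ _ _ _ (is_derive_smooth_step x e t)).
  split; [|exact: cvg_at_right_filter (c _)|exact: cvg_at_left_filter (c _)].
  by move=> t _; exact: (@ex_derive _ _ _ _ _ _ _ (is_derive_smooth_step x e t)).
- by move=> t _; apply: is_derive_derive1; exact: is_derive_smooth_step.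
Qed.

(** By unit mass the left side is the integral of [(f t - f x)] against the kernel, which is at most
    [M / e] in size. The closed interval [[x, x + e]] is enlarged to the open ball of radius
    [2 * e], of measure [4 * e]; hence the factor [4 * M]. *)
Lemma bump_mean f x e (M : R) : locally_integrable setT f -> 0 < e ->
  (forall t : R, `|derive1 smooth_step t| <= M) ->
  (`|\int[mu]_t (f t * bump_at x e t) - f x|%:E <= (4 * M)%:E * davg f x (2 * e))%E.
Proof.
move=> lf e0 hM.
have M0 : 0 <= M by exact: le_trans (hM 0).
have kM t : `|bump_at x e t| <= e^-1 * M.
  by rewrite normrM (ger0_norm (ltW _)) ?invr_gt0// ler_pM2l ?invr_gt0.
have mD : measurable `[x, x + e]%classic by exact: measurable_itv.
have ifk : mu.-integrable `[x, x + e] (EFin \o (fun t => f t * bump_at x e t)).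
  apply: integrableS (locint_integrableM lf (measurable_bump x e) kM (fun t => @bump_out x e t e0)) => //.
have ik : mu.-integrable `[x, x + e] (EFin \o bump_at x e).
  apply: continuous_compact_integrable; first exact: segment_compact.
  by apply: continuous_subspaceT; exact: continuous_bump.
have -> : \int[mu]_t (f t * bump_at x e t) = \int[mu]_(t in `[x, x + e]) (f t * bump_at x e t).
  rewrite [RHS]Rintegral_mkcond; congr Rintegral; apply/funext => t.
  rewrite patchE; case: ifPn => // tD; rewrite bump_out ?mulr0//.
  by apply: contra tD; rewrite inE.
have -> : \int[mu]_(t in `[x, x + e]) (f t * bump_at x e t) - f x =
    \int[mu]_(t in `[x, x + e]) (f t * bump_at x e t - f x * bump_at x e t).
  rewrite RintegralB//.
    by rewrite RintegralZl// integral_bump// mulr1.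
  exact: integrable_EFinZl.
rewrite EFin_normr_Rintegral//; last first.
  by apply: integrable_EFinB => //; exact: integrable_EFinZl.
have [mf _ _] := lf.
have mfD : measurable_fun `[x, x + e] f by exact: measurable_funS mf.
have mbD : measurable_fun `[x, x + e] (bump_at x e).
  exact: measurable_funS (measurable_bump x e).
apply: le_trans (le_abse_integral _ _ _) _ => //.
  by apply/measurable_EFinP; apply: measurable_funB; exact: measurable_funM.
have sub : `[x, x + e] `<=` ball x (2 * e).
  move=> t /=; rewrite in_itv/= => /andP[xt te].
  by rewrite /ball/= ltr_norml; apply/andP; split; lra.
have step1 : (\int[mu]_(t in `[x, (x + e)%R]) `|(f t * bump_at x e t - f x * bump_at x e t)%R%:E|
    <= \int[mu]_(t in `[x, (x + e)%R]) ((e^-1 * M)%R%:E * `|(f t - f x)%R%:E|))%E.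
  apply: ge0_le_integral => //.
  - apply/measurable_EFinP; apply: measurableT_comp => //.
    by apply: measurable_funB; exact: measurable_funM.
  - apply/measurable_EFinP; apply: measurable_funM => //.
    by apply: measurableT_comp => //; apply: measurable_funB.
  - move=> t _; rewrite /= -EFinM lee_fin -mulrBl normrM mulrC ler_wpM2r//.
apply: le_trans step1 _.
rewrite ge0_integralZl//; last 2 first.
  - apply/measurable_EFinP.
    by apply: measurableT_comp => //; apply: measurable_funB.
  - by rewrite lee_fin mulr_ge0// invr_ge0 ltW.
have step2 : ((e^-1 * M)%R%:E * \int[mu]_(t in `[x, (x + e)%R]) `|(f t - f x)%R%:E| <=
    (e^-1 * M)%R%:E * \int[mu]_(t in ball x (2 * e)%R) `|(f t - f x)%R%:E|)%E.
  apply: lee_wpmul2l; first by rewrite lee_fin mulr_ge0// invr_ge0 ltW.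
  apply: ge0_subset_integral => //; first exact: measurable_ball.
  apply/measurable_EFinP; apply: measurableT_comp => //.
  by apply: measurable_funB => //; exact: measurable_funS mf.
apply: le_trans step2 _.
rewrite /davg /iavg (lebesgue_measure_ball _ (ltW (mulr_gt0 _ _)))//.
rewrite inver mulrn_eq0/= gt_eqF ?mulr_gt0// muleA -EFinM.
rewrite le_eqVlt; apply/orP; left; apply/eqP; congr (_%:E * _)%E.
rewrite mulr2n; field.
by rewrite gt_eqF ?addr_gt0 ?mulr_gt0// gt_eqF.
Qed.
End WeakFTC.

(** * The fundamental theorem of calculus for weak derivatives *)

Section WeakFTC2.
Context {R : realType}.
Notation mu := (@lebesgue_measure R).
Implicit Types (f g k : R -> R) (a b x y t e : R).

Lemma cvg_bump f x : locally_integrable setT f -> lebesgue_pt f x ->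
  \int[mu]_t (f t * bump_at x (harmonic n) t) @[n --> \oo] --> f x.
Proof.
move=> lf fx; have [M [M0 hM]] := @derive1_smooth_step_bounded R.
have h2 : (fun n => 2 * @harmonic R n) @ \oo --> (0 : R)^'+.
  have : forall n, 0 < 2 * @harmonic R n by move=> n; rewrite mulr_gt0// harmonic_gt0.
  have : (fun n => 2 * @harmonic R n) @ \oo --> (0 : R).
    by rewrite -(mulr0 2); apply: cvgM; [exact: cvg_cst|exact: cvg_harmonic].
  move=> c p U /=; rewrite /at_right /within/= => /c.
  by apply: (@filterS _ (\oo)) => n /= h; apply: h; exact: (p n).
have : (fun n => davg f x (2 * harmonic n)) @ \oo --> 0%E.
  exact: (cvg_comp _ _ h2 fx).
move=> dx; have dc := cvgeZl (y := (4 * M)%:E) isT dx; rewrite mule0 in dc.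
apply/subr_cvg0/norm_cvg0P.
suff : (fun n => (`|\int[mu]_t (f t * bump_at x (harmonic n) t) - f x|)%:E) @ \oo --> 0%E.
  exact: fine_cvg.
apply: (@squeeze_cvge _ _ _ _ (cst 0%E) _ _ _ _ (cvg_cst _) dc).
near=> n; rewrite lee_fin normr_ge0/=.
exact: bump_mean (harmonic_gt0 _) hM.
Unshelve. all: by end_near. Qed.

Definition cutoff x y e t := smooth_step ((t - x) / e) - smooth_step ((t - y) / e).

Lemma cutoff_out x y e t : 0 < e -> x < y -> t \notin `[x, y + e] -> cutoff x y e t = 0.
Proof.
move=> e0 xy; rewrite in_itv/= negb_and -!ltNge => /orP h; rewrite /cutoff.
case: h => h.
  by rewrite !smooth_step0 ?subr0// pmulr_lle0 ?invr_gt0// subr_le0; lra.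
by rewrite !smooth_step1 ?subrr// ler_pdivlMr// mul1r; lra.
Qed.

Lemma cutoff_norm x y e t : `|cutoff x y e t| <= 1.
Proof.
rewrite ler_norml /cutoff; apply/andP.
have := smooth_step_ge0 ((t - x) / e); have := smooth_step_ge0 ((t - y) / e).
have := smooth_step_le1 ((t - x) / e); have := smooth_step_le1 ((t - y) / e).
by split; lra.
Qed.

Lemma is_derive_cutoff x y e t :
  is_derive t 1 (cutoff x y e) (bump_at x e t - bump_at y e t).
Proof. by apply: is_deriveB; exact: is_derive_smooth_step. Qed.

Lemma test_function_cutoff x y e : 0 < e -> x < y -> test_function (cutoff x y e).
Proof.
move=> e0 xy; split.
  apply: smooth_ndiff => n; apply: ndiffD; last apply: ndiffN.
    have := @ndiff_affine R n smooth_step e^-1 (- x / e) (ndiff_smooth_step n).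
    congr ndiff; apply/funext => t; congr smooth_step; ring.
  have := @ndiff_affine R n smooth_step e^-1 (- y / e) (ndiff_smooth_step n).
  congr ndiff; apply/funext => t; congr smooth_step; ring.
apply: (@subclosed_compact _ _ `[x, y + e]%classic).
- exact: closed_closure.
- exact: segment_compact.
- have /closure_id -> : closed `[x, y + e]%classic by exact: itv_closed.
  apply: closureS => t /= ct; apply/negPn/negP => tn.
  by move/eqP: ct; apply; apply: cutoff_out => //; apply/negP.
Qed.

Lemma continuous_cutoff x y e : continuous (cutoff x y e).
Proof.
move=> t; apply: differentiable_continuous; apply/derivable1_diffP.
exact: (@ex_derive _ _ _ _ _ _ _ (is_derive_cutoff x y e t)).
Qed.

(** The step placed at [z] is still 0 at [t = z], whatever its width, so the limit excludes the left
    end point and includes the right one. *)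
Lemma cutoff_cvg x y t : x < y ->
  cutoff x y (harmonic n) t @[n --> \oo] --> (\1_(`]x, y]%classic) t : R).
Proof.
move=> xy; have H : forall z, (\forall n \near \oo, smooth_step ((t - z) / harmonic n) = (z < t)%R%:R).
  move=> z; have [zt|tz] := ltP z t; last first.
    near=> n; rewrite smooth_step0//.
    by rewrite pmulr_lle0 ?invr_gt0 ?harmonic_gt0// subr_le0.
  have /cvgrPdist_lt := @cvg_harmonic R => /(_ (t - z)).
  rewrite subr_gt0 => /(_ zt); apply: filterS => n.
  rewrite sub0r normrN gtr0_norm ?harmonic_gt0// => h.
  by rewrite smooth_step1// ler_pdivlMr ?harmonic_gt0// mul1r ltW.
apply: cvg_near_cst; near=> n.
rewrite /cutoff (_ : smooth_step ((t - x) / _) = (x < t)%R%:R); last by near: n; exact: H.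
rewrite (_ : smooth_step ((t - y) / _) = (y < t)%R%:R); last by near: n; exact: H.
rewrite indicE mem_setE in_itv/=.
have [xt|tx] := ltP x t; have [yt|ty] := ltP y t; rewrite /= ?subr0 ?subrr//.
lra.
Unshelve. all: by end_near. Qed.

(** Testing with [cutoff x y] gives mollified values of [f] at [x] and [y] on one side, which
    converge at Lebesgue points, and a smoothed integral of [g] on the other, handled by dominated
    convergence. *)
Lemma weak_ftc f g x y : locally_integrable setT f -> locally_integrable setT g ->
  weak_derivative f g -> lebesgue_pt f x -> lebesgue_pt f y -> x < y ->
  f y - f x = \int[mu]_(t in `[x, y]) g t.
Proof.
move=> lf lg wfg fx fy xy.
have [M [M0 hM]] := @derive1_smooth_step_bounded R.
have E n : \int[mu]_t (f t * derive1 (cutoff x y (harmonic n)) t) =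
    \int[mu]_t (f t * bump_at x (harmonic n) t) - \int[mu]_t (f t * bump_at y (harmonic n) t).
  have int z : mu.-integrable setT (EFin \o (fun t => f t * bump_at z (harmonic n) t)).
    apply: (locint_integrableM (M := (harmonic n)^-1 * M) lf (measurable_bump z _) _
      (fun t => @bump_out _ z (harmonic n) t (harmonic_gt0 _))).
    move=> t; rewrite normrM (ger0_norm (ltW _)) ?invr_gt0 ?harmonic_gt0//.
    by rewrite ler_pM2l ?invr_gt0 ?harmonic_gt0.
  rewrite /= -RintegralB//; congr Rintegral; apply/funext => t.
  by rewrite (is_derive_derive1 (is_derive_cutoff _ _ _ _)) mulrBr.
have L : \int[mu]_t (f t * derive1 (cutoff x y (harmonic n)) t) @[n --> \oo] --> f x - f y.
  have -> : (fun n => \int[mu]_t (f t * derive1 (cutoff x y (harmonic n)) t)) =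
      (fun n => \int[mu]_t (f t * bump_at x (harmonic n) t) -
                \int[mu]_t (f t * bump_at y (harmonic n) t)).
    apply/funext => n; exact: E.
  exact: cvgB (cvg_bump lf fx) (cvg_bump lf fy).
have Rt : \int[mu]_t (g t * cutoff x y (harmonic n) t) @[n --> \oo] --> \int[mu]_(t in `[x, y]) g t.
  rewrite -Rintegral_itv_obnd_cbnd; last first.
    by apply: integrableS (locint_integrable x y lg) => //; exact: subset_itv_oc_cc.
  rewrite Rintegral_mkcond.
  have [mg _ _] := lg.
  (* The transition width [harmonic n = 1 / (n + 1)] is at most 1, so every cutoff is supported in
     [[x, y + 1]], and there it is at most 1 in absolute value. *)
  have := @dominated_convergence _ _ _ mu setT measurableT
    (fun n t => (g t * cutoff x y (harmonic n) t)%:E)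
    (EFin \o (g \_ `]x, y])) (EFin \o (fun t => `|g t| * \1_(`[x, y + 1]%classic) t)).
  case.
  - move=> n; apply/measurable_EFinP; apply: measurable_funM => //.
    by apply: continuous_measurable_fun; exact: continuous_cutoff.
  - by apply/measurable_EFinP/(measurable_restrictT _ _).1 => //; exact: measurable_funS mg.
  - apply: aeW => t _; apply: cvg_EFin; first by near=> n.
    have -> : (g \_ `]x, y]) t = g t * \1_(`]x, y]%classic) t.
      by rewrite patchE indicE; case: ifP; rewrite ?mulr1 ?mulr0.
    by apply: cvgM; [exact: cvg_cst|exact: cutoff_cvg].
  - have lng : locally_integrable setT (fun t => `|g t|).
      by split => //; [exact: measurableT_comp|exact: openT|
        move=> K KT cK; under eq_integral do rewrite normr_id; case: lg => _ _; exact].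
    apply: (locint_integrableM (a := x) (b := y + 1) (M := 1) lng).
    + by apply: measurable_indic; exact: measurable_itv.
    + by move=> t; rewrite indicE; case: (_ \in _); rewrite ?normr1 ?normr0.
    + by move=> t tn; rewrite indicE mem_setE (negbTE tn).
  - apply: aeW => t n _ /=; rewrite lee_fin normrM.
    rewrite indicE mem_setE; case: (boolP (t \in _)) => [_|tn].
      by rewrite ler_pM// cutoff_norm.
    rewrite cutoff_out ?normr0 ?mulr0 ?harmonic_gt0//.
    apply: contra tn; rewrite !in_itv/= => /andP[-> h] /=.
    apply: le_trans h _; rewrite lerD2l /harmonic/= invf_le1 ?ltr0n// ler1n//.
  move=> ig _ H; apply: fine_cvg; rewrite /Rintegral fineK; first exact: H.
  exact: integrable_fin_num ig.
have NR : \int[mu]_t (f t * derive1 (cutoff x y (harmonic n)) t) @[n --> \oo] -->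
    - \int[mu]_(t in `[x, y]) g t.
  rewrite (_ : (fun n => _) = fun n => - \int[mu]_t (g t * cutoff x y (harmonic n) t)).
    exact: cvgN Rt.
  by apply/funext => n; rewrite wfg//; exact: test_function_cutoff (harmonic_gt0 _) xy.
have {}E := cvg_unique (@Rhausdorff R) L NR.
by rewrite -[RHS]opprK -E; ring.
Unshelve. all: by end_near. Qed.
End WeakFTC2.

(** * Continuous representatives of weakly differentiable functions *)

Section WeakPrimitive.
Context {R : realType}.
Notation mu := (@lebesgue_measure R).
Implicit Types (f g k r : R -> R) (a b x y t e : R).

Lemma ae_exists_itv (P : R -> Prop) a b : {ae mu, forall x, P x} -> a < b ->
  exists x, a < x < b /\ P x.
Proof.
move=> [N [mN N0 sub]] ab; apply: contrapT => h.
have : (mu `]a, b[%classic <= mu N)%E.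
  apply: le_measure; rewrite ?inE// => x; rewrite /= in_itv/= => xab.
  by apply: sub => /= Px; apply: h; exists x.
rewrite N0 lebesgue_measure_itv/= lte_fin ab -EFinB lee_fin.
lra.
Qed.

Lemma locint_itvD f a x y : locally_integrable setT f -> a <= x -> x <= y ->
  \int[mu]_(t in `[a, y]) f t =
  \int[mu]_(t in `[a, x]) f t + \int[mu]_(t in `[x, y]) f t.
Proof.
move=> lf ax xy.
have := @Rintegral_itvB _ f (BLeft a) (BRight y) x (locint_integrable a y lf).
rewrite !bnd_simp => /(_ ax xy) E.
rewrite -[X in _ = _ + X]Rintegral_itv_obnd_cbnd; first by rewrite -E; ring.
by apply: integrableS (locint_integrable x y lf) => //; exact: subset_itv_oc_cc.
Qed.

Lemma continuous_locint_integral f a t : locally_integrable setT f -> a < t ->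
  {for t, continuous (fun x => \int[mu]_(s in `[a, x]) f s)}.
Proof.
move=> lf at_; have H := @parameterized_integral_continuous R a (t + 1) f.
have at1 : a <= t + 1 by lra.
have at1' : a < t + 1 by lra.
have [+ _ _] := (continuous_within_itvP _ at1').1 (H at1 (locint_integrable _ _ lf)).
by apply; rewrite in_itv/= at_ ltrDl ltr01.
Qed.

(** The primitive is normalized at a Lebesgue point [a] of [f]. Such points have full measure, so
    [a] can be found to the left of any prescribed [A]; the representative is then valid on the
    half-line to the right of [a]. *)
Lemma weak_primitive f g A : locally_integrable setT f -> locally_integrable setT g ->
  weak_derivative f g -> exists a (W : R -> R),
  [/\ a < A, forall t, a < t -> {for t, continuous W},
    forall x y, a <= x -> x <= y -> W y - W x = \int[mu]_(t in `[x, y]) g t &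
    {ae mu, forall t, a < t -> f t = W t}].
Proof.
move=> lf lg wfg; have lebf := lebesgue_differentiation lf.
have A1 : A - 1 < A by lra.
have [a [/andP[_ aA] la]] := ae_exists_itv lebf A1.
exists a, (fun t => f a + \int[mu]_(s in `[a, t]) g s); split => //.
- move=> t at_; apply: cvgD; first exact: cvg_cst.
  exact: continuous_locint_integral.
- by move=> x y ax xy; rewrite (locint_itvD lg ax xy); ring.
- apply: (@filterS _ _ (ae_filter_ringOfSetsType mu)) lebf => t lt at_.
  by rewrite -(weak_ftc lf lg wfg la lt at_); ring.
Qed.

(** A monotone function equal almost everywhere to a continuous one is equal to it everywhere: each
    value is squeezed between values at nearby points of agreement on either side. The pointwise
    condition [r 0 = rs] thereby concerns the continuous representative. *)
Lemma weak_primitive_monotone r dr : locally_integrable setT r ->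
  locally_integrable setT dr -> weak_derivative r dr -> {homo r : x y / x <= y} ->
  continuous r /\ forall x y, x <= y -> r y - r x = \int[mu]_(t in `[x, y]) dr t.
Proof.
move=> lr ld wd mr.
have H A : exists a (W : R -> R),
  [/\ a < A, forall t, a < t -> {for t, continuous W},
    forall x y, a <= x -> x <= y -> W y - W x = \int[mu]_(t in `[x, y]) dr t &
    forall t, a < t -> r t = W t].
  have [a [W [aA cW dW rW]]] := weak_primitive A lr ld wd.
  exists a, W; split => // t at_.
  have cWt := cW _ at_.
  have ex e : 0 < e -> `|W t - r t| <= e.
    move=> e0; move/cvgrPdist_le : (cWt) => /(_ _ e0) [d /= d0 hd].
    have [x1 [/andP[x1l x1r] h1]] := @ae_exists_itv _ (Order.max a (t - d)) t rW
      ltac:(by rewrite gt_max at_/= ltrBlDr ltrDl).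
    have [x2 [/andP[x2l x2r] h2]] := @ae_exists_itv _ t (t + d) rW ltac:(by rewrite ltrDl).
    move: x1l; rewrite gt_max => /andP[ax1 tx1].
    have b1 : `|W t - W x1| <= e by apply: hd; rewrite /= ger0_norm; lra.
    have b2 : `|W t - W x2| <= e by apply: hd; rewrite /= ltr0_norm; lra.
    have r1 : W x1 <= r t by rewrite -h1//; apply: mr; exact: ltW.
    have r2 : r t <= W x2 by rewrite -h2; [apply: mr; exact: ltW|lra].
    move: b1 b2; rewrite !ler_norml => /andP[? ?] /andP[? ?]; apply/andP; split; lra.
  apply/eqP; rewrite eq_sym -subr_eq0 -normr_eq0 eq_le normr_ge0 andbT.
  by apply/ler_addgt0Pl => e e0; rewrite addr0; exact: ex.
split.
  move=> t; have [a [W [aA cW dW rW]]] := H t.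
  have c : W @ t --> W t := cW _ aA; rewrite /continuous_at rW//.
  apply: cvg_trans c; apply: near_eq_cvg; near=> s.
  by apply/esym/rW; near: s; exact: lt_nbhsr.
move=> x y xy; have [a [W [aA cW dW rW]]] := H x.
rewrite rW ?(lt_le_trans aA)// rW// dW//; exact: ltW.
Unshelve. all: by end_near. Qed.
End WeakPrimitive.

(** * Local integrability: products, comparison and square-integrable functions *)

Section LocallyIntegrable.
Context {R : realType}.
Notation mu := (@lebesgue_measure R).
Implicit Types (f g k r : R -> R) (a b x y t e : R).

Lemma locint_bounded f k (M : R) : locally_integrable setT f ->
  measurable_fun setT k -> (forall t, `|k t| <= M) ->
  locally_integrable setT (fun t => k t * f t).
Proof.
move=> [mf oT lf] mk kM; split => //; first exact: measurable_funM.
move=> K KT cK; have mK := compact_measurable cK.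
have M0 : 0 <= M by exact: le_trans (kM 0).
apply: (@le_lt_trans _ _ (\int[mu]_(x in K) (M%:E * `|f x|%:E))%E).
  apply: ge0_le_integral => //=.
  - apply/measurable_EFinP; apply: measurableT_comp => //.
    by apply: measurable_funM; [exact: measurable_funS mk|exact: measurable_funS mf].
  - apply/measurable_EFinP; apply: measurable_funM => //.
    by apply: measurableT_comp => //; exact: measurable_funS mf.
  - by move=> x _; rewrite -EFinM lee_fin normrM ler_wpM2r.
rewrite ge0_integralZl//.
  by apply: lte_mul_pinfty; rewrite ?lee_fin//; exact: lf.
apply/measurable_EFinP; apply: measurableT_comp => //.
exact: measurable_funS mf.
Qed.

Lemma locint_cst (c : R) : locally_integrable setT (fun _ : R => c).
Proof.
split => //; first exact: openT.
move=> K KT cK; rewrite integral_cst/=; last exact: compact_measurable.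
by apply: lte_mul_pinfty => //; exact: compact_finite_measure.
Qed.

Lemma locint_le f g : locally_integrable setT g -> measurable_fun setT f ->
  (forall t, `|f t| <= g t) -> locally_integrable setT f.
Proof.
move=> [mg oT lg] mf fg; split => // K KT cK.
apply: le_lt_trans (lg K KT cK); have mK := compact_measurable cK.
apply: ge0_le_integral => //=.
- by apply/measurable_EFinP; apply: measurableT_comp => //; exact: measurable_funS mf.
- by apply/measurable_EFinP; apply: measurableT_comp => //; exact: measurable_funS mg.
- by move=> x _; rewrite lee_fin (le_trans (fg x))// ler_norm.
Qed.

Lemma L2loc_locint f : L2loc f -> locally_integrable setT f.
Proof.
move=> [mf lf2]; apply: (locint_le (g := (fun=> 1) \+ (fun t => f t ^+ 2))) => //.
  by apply: locally_integrableD => //; exact: locint_cst.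
move=> t /=; rewrite -(real_normK (num_real (f t))).
by have := sqr_ge0 (`|f t| - 1); have := normr_ge0 (f t); nra.
Qed.

End LocallyIntegrable.

(** * One-dimensional calculus *)

Section RealLemmas.
Context {R : realType}.
Implicit Types (x y t : R).

Lemma is_derive_continuous (f : R -> R) x (df : R) : is_derive x 1 f df -> {for x, continuous f}.
Proof.
move=> h; apply: differentiable_continuous; apply/derivable1_diffP.
exact: (@ex_derive _ _ _ _ _ _ _ h).
Qed.

Lemma MVT_is_derive (f df : R -> R) x y : x < y ->
  (forall z, x <= z <= y -> is_derive z 1 f (df z)) ->
  exists2 c, x < c < y & f y - f x = df c * (y - x).
Proof.
move=> xy h; have [||c cxy E] := @MVT R f df x y xy.
- by move=> z; rewrite in_itv/= => /andP[xz zy]; apply: h; rewrite !ltW.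
- apply: continuous_in_subspaceT => z; rewrite inE/= in_itv/= => zxy.
  exact: is_derive_continuous (h _ zxy).
by rewrite in_itv/= in cxy; exists c.
Qed.

(** Replacing [f] by its continuous version [k] leaves the integral unchanged, and the classical
    theorem of calculus then applies. This turns weak information on the wave and on its flux into
    genuine derivatives. *)
Lemma primitive_is_derive (F f k : R -> R) x1 y1 t :
  locally_integrable setT f ->
  (forall y, x1 <= y -> F y - F x1 = \int[lebesgue_measure]_(s in `[x1, y]) f s) ->
  {ae lebesgue_measure, forall s, x1 <= s <= y1 -> f s = k s} ->
  (forall s, x1 <= s <= y1 -> {for s, continuous k}) -> x1 < t < y1 ->
  is_derive t 1 F (k t).
Proof.
move=> lf Ff fk ck /andP[xt ty].
have wk y : y <= y1 -> {within `[x1, y], continuous k}.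
  move=> yy1; apply: continuous_in_subspaceT => s; rewrite inE/= in_itv/= => /andP[xs sy].
  by apply: ck; rewrite xs (le_trans sy).
have ik y : y <= y1 -> lebesgue_measure.-integrable `[x1, y] (EFin \o k).
  by move=> yy1; apply: continuous_compact_integrable; [exact: segment_compact|exact: wk].
have Fk y : x1 <= y -> y <= y1 -> F y = F x1 + \int[lebesgue_measure]_(s in `[x1, y]) k s.
  move=> xy yy1; rewrite -[LHS](subrKC (F x1)) Ff//; congr (_ + fine _).
  apply: ae_eq_integral => //.
  - exact: (measurable_int lebesgue_measure (locint_integrable x1 y lf)).
  - exact: (measurable_int lebesgue_measure (ik _ yy1)).
  - apply: (@filterS _ _ (ae_filter_ringOfSetsType _)) fk => s fks.
    by rewrite /= in_itv/= => /andP[xs sy]; rewrite fks// xs (le_trans sy).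
have ckt : {for t, continuous k} by apply: ck; rewrite !ltW.
have [dI I1] := @continuous_FTC1_closed _ k x1 t y1 ty (ik _ (lexx _)) xt ckt.
have dI' : is_derive t 1 (fun y => \int[lebesgue_measure]_(s in `[x1, y]) k s) (k t).
  by rewrite -I1; exact: derivable_is_derive.
have H := is_deriveD (is_derive_cst (F x1) t 1) dI'.
rewrite add0r in H.
apply: near_eq_is_derive H; near=> y.
rewrite [RHS]Fk; first by [].
  by apply/ltW; near: y; exact: lt_nbhsr.
by apply/ltW; near: y; exact: lt_nbhsl.
Unshelve. all: by end_near. Qed.

Lemma homo_derive1_ge0 (f : R -> R) t : {homo f : x y / x <= y} ->
  derivable f t 1 -> 0 <= derive1 f t.
Proof.
move=> mf df; rewrite derive1E; apply: limr_ge; first exact: df.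
near=> h; rewrite /= /shift/= /GRing.scale/= mulr1.
have : h != 0 by near: h; exact: nbhs_dnbhs_neq.
rewrite neq_lt => /orP[h0|h0].
  rewrite nmulr_rge0 ?invr_lt0// subr_le0; apply: mf.
  by rewrite gerDr ltW.
rewrite pmulr_rge0 ?invr_gt0// subr_ge0; apply: mf.
by rewrite lerDr ltW.
Unshelve. all: by end_near. Qed.

(** The mean value theorem is applied to [F] minus the primitive of [h], so that [dF] is only
    evaluated at interior points. The sonic point can therefore serve as an end point of the
    interval. *)
Lemma integral_le_increment (h F dF : R -> R) x y : x <= y ->
  continuous h -> continuous F ->
  (forall t, x < t < y -> is_derive t 1 F (dF t)) ->
  (forall t, x < t < y -> h t <= dF t) ->
  \int[lebesgue_measure]_(t in `[x, y]) h t <= F y - F x.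
Proof.
rewrite le_eqVlt => /predU1P[<- _ _ _ _|xy ch cF dFt hF].
  by rewrite set_itv1 Rintegral_set1 subrr.
have ih : lebesgue_measure.-integrable `[x, y] (EFin \o h).
  apply: continuous_compact_integrable; first exact: segment_compact.
  exact: continuous_subspaceT.
pose I t := \int[lebesgue_measure]_(s in `[x, t]) h s.
have dI t : x < t < y -> is_derive t 1 I (h t).
  move=> /andP[xt ty].
  have [dI It] := @continuous_FTC1_closed _ h x t y ty ih xt (ch t).
  by rewrite -It; exact: derivable_is_derive.
have cI : {within `[x, y], continuous I} by apply: parameterized_integral_continuous => //; exact: ltW.
have [||c cxy E] := @MVT R (fun t => F t - I t) (fun t => dF t - h t) x y xy.
- by move=> t; rewrite in_itv/= => txy; apply: is_deriveB; [exact: dFt|exact: dI].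
- move=> t; apply: cvgB; last exact: cI.
  by apply: continuous_subspaceT.
rewrite in_itv/= in cxy; rewrite -subr_ge0.
have : 0 <= F y - I y - (F x - I x).
  by rewrite E mulr_ge0// subr_ge0; [exact: hF|exact: ltW].
have -> // : F y - I y - (F x - I x) = F y - F x - I y.
by rewrite {2}/I set_itv1 Rintegral_set1; ring.
Qed.

(* Conservation-law argument: [alpha u^2 - (K h)^2] is nondecreasing and has a
   nonnegative lower limit at [-oo]. *)
Lemma energy_ge (alpha K b : R) (u h du dh : R -> R) : 0 <= alpha ->
  (forall t, t < b -> is_derive t 1 u (du t)) ->
  (forall t, t < b -> is_derive t 1 h (dh t)) ->
  (forall t, t < b -> K ^+ 2 * (h t * dh t) <= alpha * (u t * du t)) ->
  h t @[t --> -oo] --> 0 ->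
  forall t, t < b -> K ^+ 2 * h t ^+ 2 <= alpha * u t ^+ 2.
Proof.
move=> a0 hu hh le h0 t tb.
pose E s := alpha * (u s * u s) - K ^+ 2 * (h s * h s).
have dE s : s < b -> is_derive s 1 E (2 * (alpha * (u s * du s) - K ^+ 2 * (h s * dh s))).
  move=> sb; have us := hu s sb; have hs := hh s sb.
  have H := is_deriveB (is_deriveM (is_derive_cst alpha s 1) (is_deriveM us us))
    (is_deriveM (is_derive_cst (K ^+ 2) s 1) (is_deriveM hs hs)).
  refine (is_derive_eq H _); rewrite /cst /GRing.scale/=; ring.
have mono s : s < t -> E s <= E t.
  move=> st; have [|c /andP[sc ct] e] := @MVT_is_derive E
      (fun s => 2 * (alpha * (u s * du s) - K ^+ 2 * (h s * dh s))) s t st.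
    by move=> z /andP[_ zt]; apply: dE; exact: le_lt_trans tb.
  rewrite -subr_ge0 e mulr_ge0 ?subr_ge0 ?(ltW st)// mulr_ge0// subr_ge0.
  by apply: le; exact: lt_trans tb.
rewrite -subr_ge0 !expr2 -/(E t) leNgt; apply/negP => Et.
(* If [E t < 0], then far to the left [E s >= - K^2 h(s)^2 > E t], which contradicts
   monotonicity. *)
have lim : K ^+ 2 * (h s * h s) @[s --> -oo] --> 0.
  by rewrite -(mulr0 (K ^+ 2)) -(mulr0 0); apply: cvgM; [exact: cvg_cst|exact: cvgM].
have [s [st sE]] : exists s, s < t /\ K ^+ 2 * (h s * h s) < - E t.
  have near_s : \forall s \near -oo, s < t /\ K ^+ 2 * (h s * h s) < - E t.
    near=> s; split; first by near: s; apply: nbhs_ninfty_lt; exact: num_real.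
    by near: s; apply: (cvgr_lt _ lim); lra.
  by have [s hs] := filter_ex near_s; exists s.
have := mono _ st; rewrite {1}/E => sle.
have : 0 <= alpha * (u s * u s) by rewrite mulr_ge0// -expr2 sqr_ge0.
lra.
Unshelve. all: by end_near. Qed.

(* Provides the hypothesis of [energy_ge] with [y] the density, [x] its distance
   to the limit state, [D = |S'|], and [u], [d] the logarithmic derivative of
   [y] and its derivative, up to orientation. *)
Lemma speed_balance (alpha D d u s x y p : R) : 0 < alpha -> 0 < D ->
  0 < y -> y <= p -> 0 <= x -> 0 <= u -> D * x <= s -> s / (alpha * y) <= d * D ->
  p^-1 ^+ 2 * (x * (y * u)) <= alpha * (u * d).
Proof.
move=> a0 D0 y0 yp x0 u0 Dx sd; have p0 : 0 < p by exact: lt_le_trans yp.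
have ay : 0 < alpha * y by rewrite mulr_gt0.
have xd : x <= alpha * y * d.
  rewrite -(ler_pM2l D0) (le_trans Dx)//.
  by move: sd; rewrite ler_pdivrMr// => /le_trans; apply; rewrite le_eqVlt; apply/orP; left; apply/eqP; ring.
(* With [x <= alpha * y * d] this is at least [u * x / y], and the weight [y / p^2] on the left is
   at most [1 / y] because [y <= p]. *)
have E : alpha * (u * d) = u * (alpha * y * d) / y by field; rewrite gt_eqF.
rewrite E ler_pdivlMr// (_ : p^-1 ^+ 2 * (x * (y * u)) * y = u * x * (y / p) ^+ 2); last first.
  by field; rewrite gt_eqF.
apply: (@le_trans _ _ (u * x)); last by rewrite ler_wpM2l.
rewrite -[leRHS]mulr1 ler_wpM2l ?mulr_ge0// expr_le1// ?divr_ge0 ?(ltW y0) ?(ltW p0)//.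
by rewrite ler_pdivrMr// mul1r.
Qed.

End RealLemmas.

(** * The traveling wave *)

Section Flux.
Context {R : realType}.
Implicit Types (x y t : R).
Variables (m rm rp rs : R) (S S2 : R -> R).
Hypotheses (rm_gt0 : 0 < rm) (rm_rs : rm < rs) (rs_rp : rs < rp) (m_neq0 : m != 0).
Hypothesis dS : forall x, 0 < x -> is_derive x 1 S (derive1 S x).
Hypothesis ddS : forall x, 0 < x -> is_derive x 1 (derive1 S) (S2 x).
Hypothesis S2_le : forall x, 0 < x -> S2 x <= - (2 * m ^+ 2 / x ^+ 3).
Hypotheses (S_rm : S rm = 0) (S_rp : S rp = 0) (dS_rs : derive1 S rs = 0).

Let S2_lt0 x : 0 < x -> S2 x < 0.
Proof.
move=> x0; apply: le_lt_trans (S2_le x0) _.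
by rewrite oppr_lt0 divr_gt0 ?exprn_gt0// mulr_gt0// exprn_even_gt0.
Qed.

Lemma dS_decr x y : 0 < x -> x < y -> derive1 S y < derive1 S x.
Proof.
move=> x0 xy; have [z /andP[xz _] E] : exists2 c, x < c < y & derive1 S y - derive1 S x = S2 c * (y - x).
  by apply: MVT_is_derive => // z /andP[xz _]; apply: ddS; exact: lt_le_trans xz.
rewrite -subr_lt0 E nmulr_rlt0 ?subr_gt0//.
by apply: S2_lt0; exact: lt_trans xz.
Qed.

Lemma dS_gt0 x : 0 < x -> x < rs -> 0 < derive1 S x.
Proof. by move=> x0 /(dS_decr x0); rewrite dS_rs. Qed.

Lemma dS_lt0 x : rs < x -> derive1 S x < 0.
Proof. by move=> /dS_decr; rewrite dS_rs; apply; exact: lt_trans rm_rs. Qed.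

Lemma dS_neq0 x : 0 < x -> x != rs -> derive1 S x != 0.
Proof.
move=> x0; rewrite neq_lt => /orP[h|h]; first by rewrite gt_eqF// dS_gt0.
by rewrite lt_eqF// dS_lt0.
Qed.

Lemma S_ge_left x : rm <= x -> derive1 S x * (x - rm) <= S x.
Proof.
rewrite le_eqVlt => /predU1P[<-|rmx]; first by rewrite subrr mulr0 S_rm.
have [z /andP[rz zx] E] : exists2 c, rm < c < x & S x - S rm = derive1 S c * (x - rm).
  by apply: MVT_is_derive => // z /andP[xz _]; apply: dS; exact: lt_le_trans xz.
rewrite S_rm subr0 in E; rewrite E ler_pM2r ?subr_gt0// ltW//.
by apply: dS_decr => //; exact: lt_trans rz.
Qed.

Lemma S_ge_right x : 0 < x -> x <= rp -> - derive1 S x * (rp - x) <= S x.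
Proof.
move=> x0; rewrite le_eqVlt => /predU1P[->|xrp]; first by rewrite subrr mulr0 S_rp.
have [z /andP[xz zr] E] : exists2 c, x < c < rp & S rp - S x = derive1 S c * (rp - x).
  by apply: MVT_is_derive => // z /andP[xz _]; apply: dS; exact: lt_le_trans xz.
rewrite S_rp sub0r in E; rewrite -[S x]opprK E mulNr lerN2 ler_pM2r ?subr_gt0// ltW//.
exact: dS_decr.
Qed.

(** [S] vanishes at [rm] and increases strictly up to [rs]. This positivity is what makes a plateau
    at the sonic value contradictory. *)
Lemma S_rs_gt0 : 0 < S rs.
Proof.
have [z /andP[rz zx] E] : exists2 c, rm < c < rs & S rs - S rm = derive1 S c * (rs - rm).
  by apply: MVT_is_derive => // z /andP[xz _]; apply: dS; exact: lt_le_trans xz.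
rewrite S_rm subr0 in E; rewrite E mulr_gt0 ?subr_gt0// dS_gt0//.
exact: lt_trans rz.
Qed.

(** * A fixed wave: regularity, speed and integral bounds *)

Section Wave.
Notation mu := (@lebesgue_measure R).
Variables (alpha : R) (r dr : R -> R).
Hypotheses (alpha_gt0 : 0 < alpha) (r_mono : {homo r : x y / x <= y}).
Hypothesis r_range : forall t, rm <= r t <= rp.
Hypotheses (r_Ny : r t @[t --> -oo] --> rm) (r_y : r t @[t --> +oo] --> rp).
Hypotheses (r_L2 : L2loc r) (dr_L2 : L2loc dr) (r_dr : weak_derivative r dr).
Hypothesis r_eq : forall phi, test_function phi ->
  \int[mu]_xi (alpha * (derive1 S (r xi) / r xi) * dr xi * derive1 phi xi)
  + \int[mu]_xi ((S (r xi) / r xi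
      - 2 * alpha * (m ^+ 2 / r xi ^+ 4) * dr xi ^+ 2) * phi xi) = 0.

Lemma r_gt0 t : 0 < r t.
Proof. by have /andP[h _] := r_range t; exact: lt_le_trans h. Qed.

Lemma r_primitive : continuous r /\ forall x y, x <= y -> r y - r x = \int[mu]_(t in `[x, y]) dr t.
Proof. by apply: weak_primitive_monotone => //; exact: L2loc_locint. Qed.

Lemma r_continuous : continuous r.
Proof. by have [] := r_primitive. Qed.

Lemma comp_r_continuous (h : R -> R) t :
  (forall x, 0 < x -> {for x, continuous h}) -> {for t, continuous (fun s => h (r s))}.
Proof.
move=> ch; apply: continuous_comp; first exact: r_continuous.
by apply: ch; exact: r_gt0.
Qed.

Lemma comp_r_bounded (h : R -> R) :
  (forall x, 0 < x -> {for x, continuous h}) -> exists M : R, forall t, `|h (r t)| <= M.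
Proof.
move=> ch; have rmp : rm <= rp by rewrite ltW// (lt_trans rm_rs).
have [|c _ cmax] := @EVT_max R (fun x => `|h x|) rm rp rmp.
  apply: continuous_in_subspaceT => x; rewrite inE/= in_itv/= => /andP[rx _].
  apply: (@continuous_comp _ _ _ h); last exact: norm_continuous.
  by apply: ch; exact: lt_le_trans rx.
by exists `|h c| => t; apply: cmax; rewrite in_itv/= r_range.
Qed.

Lemma comp_r_locint (h f : R -> R) : (forall x, 0 < x -> {for x, continuous h}) ->
  locally_integrable setT f -> locally_integrable setT (fun t => h (r t) * f t).
Proof.
move=> ch lf; have [M hM] := comp_r_bounded ch.
apply: (locint_bounded (M := M)) => //.
by apply: continuous_measurable_fun => t; exact: comp_r_continuous.
Qed.

Definition flux t := alpha * (derive1 S (r t) / r t) * dr t.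
Definition source t := S (r t) / r t - 2 * alpha * (m ^+ 2 / r t ^+ 4) * dr t ^+ 2.

Let S_cont x : 0 < x -> {for x, continuous S}.
Proof. by move=> x0; exact: is_derive_continuous (dS x0). Qed.
Let dS_cont x : 0 < x -> {for x, continuous (derive1 S)}.
Proof. by move=> x0; exact: is_derive_continuous (ddS x0). Qed.
Let V_cont x : 0 < x -> {for x, continuous (fun x => x^-1 : R)}.
Proof. by move=> x0; apply: cvgV; [rewrite gt_eqF|exact: cvg_id]. Qed.

Lemma flux_coef_cont x : 0 < x -> {for x, continuous (fun x => alpha * (derive1 S x / x))}.
Proof.
move=> x0; apply: cvgM; first exact: cvg_cst.
by apply: cvgM; [exact: dS_cont|exact: V_cont].
Qed.

Lemma source_coef_cont x : 0 < x -> {for x, continuous (fun x => S x / x)}.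
Proof. by move=> x0; apply: cvgM; [exact: S_cont|exact: V_cont]. Qed.

Lemma source_coef2_cont x : 0 < x ->
  {for x, continuous (fun x => 2 * alpha * (m ^+ 2 / x ^+ 4))}.
Proof.
move=> x0; apply: cvgM; first exact: cvg_cst.
apply: cvgM; first exact: cvg_cst.
apply: cvgV; first by rewrite expf_neq0// gt_eqF.
exact: exprn_continuous.
Qed.

Lemma flux_locint : locally_integrable setT flux.
Proof. exact: comp_r_locint flux_coef_cont (L2loc_locint dr_L2). Qed.

Lemma source_locint : locally_integrable setT source.
Proof.
apply: locally_integrableB.
  have := comp_r_locint source_coef_cont (locint_cst 1).
  by under eq_fun do rewrite mulr1.
apply: (comp_r_locint source_coef2_cont).
by case: dr_L2.
Qed.

Lemma flux_weak : weak_derivative flux source.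
Proof. by move=> phi tphi; apply/eqP; rewrite -addr_eq0 r_eq. Qed.


(** A two-step bootstrap. The flux has a continuous version [W], and dividing by the nonzero
    coefficient gives a continuous version of [dr], so [r] is continuously differentiable near [t].
    Then the source has a continuous version too, so [W], and with it [U], is differentiable at
    [t]. *)
Lemma wave_regular t : r t != rs -> exists (U : R -> R) (dU : R),
  [/\ \forall s \near t, is_derive (s : R) 1 r (r s * U s), is_derive t 1 U dU &
    S (r t) / (alpha * r t) <= dU * derive1 S (r t)].
Proof.
move=> rt; pose D s := derive1 S (r s).
have cD s : {for s, continuous D} by exact: comp_r_continuous.
have Dt0 : D t != 0 by apply: dS_neq0 => //; exact: r_gt0.
have : \forall s \near t, D s != 0 by exact: (cvgr_neq0 (D t) (cD t) Dt0).
move=> [d /= d0 hd].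
have {}hd s : t - d < s < t + d -> D s != 0.
  by move=> h; apply: hd => /=; rewrite ltr_distlC.
have [a [W [aA cW dW fW]]] := weak_primitive (t - d) flux_locint source_locint flux_weak.
(* Solving [W = alpha * (D / r) * dr] for [dr / r]: [U] is the logarithmic derivative of [r]. *)
pose U s := W s / (alpha * D s).
pose k s := r s * U s.
have aD0 s : t - d < s < t + d -> alpha * D s != 0.
  by move=> /hd Ds; rewrite mulf_neq0// gt_eqF.
have ck s : t - d < s < t + d -> {for s, continuous k}.
  move=> sd; apply: cvgM; first exact: r_continuous.
  apply: cvgM; first by apply: cW; case/andP: sd => [sd _]; exact: lt_trans sd.
  apply: cvgV; first exact: aD0.
  by apply: cvgM; [exact: cvg_cst|exact: cD].
have in_d s : t - d / 2 <= s <= t + d / 2 -> t - d < s < t + d.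
  by move=> /andP[? ?]; apply/andP; split; lra.
have drk : {ae mu, forall s, t - d < s < t + d -> dr s = k s}.
  apply: (@filterS _ _ (ae_filter_ringOfSetsType _)) fW => s fWs sd.
  rewrite /k /U -fWs /flux -/(D s); last by case/andP: sd => [sd _]; exact: lt_trans sd.
  by field; rewrite (gt_eqF alpha_gt0) (gt_eqF (r_gt0 s)) hd.
have dr_k s : t - d / 2 < s < t + d / 2 -> is_derive s 1 r (k s).
  move=> sd; apply: (@primitive_is_derive R r dr k (t - d / 2) (t + d / 2)) => //.
  - exact: L2loc_locint.
  - by move=> y xy; have [_ ->] := r_primitive.
  - apply: (@filterS _ _ (ae_filter_ringOfSetsType _)) drk => x h /in_d; exact: h.
  - by move=> x /in_d; exact: ck.
pose G s := S (r s) / r s - 2 * alpha * (m ^+ 2 / r s ^+ 4) * k s ^+ 2.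
have dWt : is_derive t 1 W (G t).
  apply: (@primitive_is_derive R W source G (t - d / 2) (t + d / 2)) => //.
  - exact: source_locint.
  - by move=> y xy; rewrite dW//; lra.
  - apply: (@filterS _ _ (ae_filter_ringOfSetsType _)) drk => x h /in_d xd.
    by rewrite /source h.
  - move=> x /in_d xd; apply: cvgB; first exact: (@comp_r_continuous (fun x => S x / x) x source_coef_cont).
    apply: cvgM; first exact: (@comp_r_continuous (fun x => 2 * alpha * (m ^+ 2 / x ^+ 4)) x source_coef2_cont).
    by apply: cvgM; exact: ck.
  - by apply/andP; split; lra.
have tt : t - d / 2 < t < t + d / 2 by apply/andP; split; lra.
have dD : is_derive t 1 D (S2 (r t) * k t).
  by apply: is_derive1_comp; [exact/ddS/r_gt0|exact: dr_k].
have tdt : t - d < t < t + d by apply/andP; split; lra.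
have daD := is_deriveM (is_derive_cst alpha t 1) dD.
have dV := @is_deriveV _ (fun s => alpha * D s) t _ 1 (aD0 _ tdt) daD.
have dU := is_deriveM dWt dV.
refine (ex_intro _ U (ex_intro _ _ (And3 _ dU _))); last first.
- have := S2_le (r_gt0 t); rewrite -subr_ge0 => S2t.
  have rt0 := r_gt0 t.
  rewrite -subr_ge0.
  have WE : W t = alpha * D t * U t by rewrite /U mulrC divfK// aD0.
  set X := (X in 0 <= X).
  (* The [S] terms cancel, and what remains is the quadratic term of the source together with the
     one from differentiating [D]. *)
  have -> : X = r t * U t ^+ 2 * (- (2 * m ^+ 2 / r t ^+ 3) - S2 (r t)).
    rewrite /X /cst /GRing.scale/= WE -/(D t) /G /k.
    by field; rewrite (gt_eqF alpha_gt0) (gt_eqF rt0) hd.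
  exact: (mulr_ge0 (mulr_ge0 (ltW rt0) (sqr_ge0 _)) S2t).
near=> s; apply: dr_k; apply/andP; split; near: s.
  by apply: lt_nbhsr; lra.
by apply: lt_nbhsl; lra.
Unshelve. all: by end_near. Qed.


(** [derive1] is total, so this is defined everywhere, but it is known to be the logarithmic
    derivative only where [r t != rs]. *)
Definition log_speed t := derive1 r t / r t.

(** The function [U] of [wave_regular] depends on the point [t]; it agrees near [t] with
    [log_speed], which is one function for the whole line and can enter the energy argument. *)
Lemma wave_speed t : r t != rs ->
  [/\ is_derive t 1 r (r t * log_speed t), 0 <= log_speed t,
    is_derive t 1 log_speed (derive1 log_speed t) &
    S (r t) / (alpha * r t) <= derive1 log_speed t * derive1 S (r t)].
Proof.
move=> rt; have [U [dU [nU DU le]]] := wave_regular rt.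
have E : \forall s \near t, U s = log_speed s.
  apply: filterS nU => s sU; rewrite /log_speed (is_derive_derive1 sU) mulrC mulKf//.
  by rewrite gt_eqF// r_gt0.
have dl : is_derive t 1 log_speed dU by exact: near_eq_is_derive E DU.
have rU := nbhs_singleton nU; have Ut := nbhs_singleton E.
rewrite Ut in rU; split => //.
- rewrite divr_ge0 ?(ltW (r_gt0 _))//; apply: homo_derive1_ge0 => //.
- by apply: derivable_is_derive; exact: (@ex_derive _ _ _ _ _ _ _ dl).
- by rewrite (is_derive_derive1 dl).
Qed.

(** On an interval where [r = rs] the derivative vanishes almost everywhere, and so does the flux,
    while the source equals the positive constant [S rs / rs]. The integral identity for the flux
    then fails. *)
Lemma no_plateau a b : a < b -> exists t, a < t < b /\ r t != rs.
Proof.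
move=> ab; apply: contrapT => h.
have rE t : a < t < b -> r t = rs.
  by move=> tab; apply/eqP/negPn/negP => rt; apply: h; exists t.
have ldr := L2loc_locint dr_L2.
have dr0 : {ae mu, forall t, a < t < b -> dr t = 0}.
  apply: (@filterS _ _ (ae_filter_ringOfSetsType _)) (lebesgue_differentiation ldr) => t lt tab.
  have /andP[at_ tb] := tab.
  have t1 : t < t + 1 by rewrite ltrDl.
  have xt : (a + t) / 2 < t by lra.
  (* At a Lebesgue point [dr t] is the derivative of a primitive of [dr]; near [t] that primitive is
     an increment of the constant [r], hence zero. *)
  have [_ <-] := @FTC1_lebesgue_pt _ dr (BLeft ((a + t) / 2)) t (t + 1) t1
    (locint_integrable _ _ ldr) xt lt.
  apply: is_derive_derive1.
  apply: (@near_eq_is_derive _ _ _ (cst 0)); near=> s.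
  have [_ <-] := r_primitive; last first.
    by apply: ltW; near: s; apply: lt_nbhsr; lra.
  rewrite !rE ?subrr//; apply/andP; split; try lra.
    by near: s; exact: lt_nbhsr.
  by near: s; exact: lt_nbhsl.
have [a0 [W [a0a cW dW fW]]] := weak_primitive a flux_locint source_locint flux_weak.
have W0 : {ae mu, forall t, a < t < b -> W t = 0}.
  apply: (@filterS _ _ (ae_filter_ringOfSetsType _)) fW => t fWt tab.
  rewrite -fWt /flux ?rE// ?dS_rs; first by rewrite mul0r mulr0 mul0r.
  by case/andP: tab => at_ _; exact: lt_trans at_.
(* Zeros of [W] are known only almost everywhere; taking one in each half of the interval gives
   [x < y]. *)
have [x [/andP[ax xc] Wx]] := @ae_exists_itv _ _ a ((a + b) / 2) W0 ltac:(lra).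
have [y [/andP[cy yb] Wy]] := @ae_exists_itv _ _ ((a + b) / 2) b W0 ltac:(lra).
have xy : x < y by lra.
have := dW x y ltac:(lra) (ltW xy).
rewrite Wx ?Wy; [|by apply/andP; split; lra..].
rewrite subrr.
have -> : \int[mu]_(t in `[x, y]) source t = \int[mu]_(t in `[x, y]) (cst (S rs / rs) t).
  congr fine; apply: ae_eq_integral => //.
  - exact: (measurable_int mu (locint_integrable x y source_locint)).
  - apply/measurable_EFinP; exact: measurable_cst.
  - apply: (@filterS _ _ (ae_filter_ringOfSetsType _)) dr0 => t drt.
    rewrite /= in_itv/= => /andP[xt ty]; rewrite /source.
    have tab : a < t < b by apply/andP; split; lra.
    by rewrite drt// rE// expr0n/= mulr0 subr0.
rewrite Rintegral_cst//= lebesgue_measure_itv/= lte_fin xy -EFinB/= => /esym/eqP.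
rewrite mulf_eq0 subr_eq0 (gt_eqF xy) orbF.
by rewrite gt_eqF// divr_gt0 ?S_rs_gt0// (lt_trans rm_gt0).
Unshelve. all: by end_near. Qed.

Hypothesis r0 : r 0 = rs.

Lemma r_lt t : t < 0 -> r t < rs.
Proof.
move=> t0; rewrite lt_neqAle -{2}r0 r_mono ?(ltW t0)// andbT.
apply/eqP => rt; have [s [/andP[ts s0]]] := no_plateau t0.
by rewrite eq_le -{1}r0 -rt !r_mono ?ltW.
Qed.

Lemma r_gt t : 0 < t -> rs < r t.
Proof.
move=> t0; rewrite lt_neqAle -{2}r0 r_mono ?(ltW t0)// andbT eq_sym.
apply/eqP => rt; have [s [/andP[ts s0]]] := no_plateau t0.
by rewrite eq_le -{1}rt -r0 !r_mono ?ltW.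
Qed.

Let rp_gt0 : 0 < rp.
Proof. by rewrite (lt_trans rm_gt0)// (lt_trans rm_rs). Qed.

Lemma log_speed_ge_left t : t < 0 -> (r t - rm) / rp <= Num.sqrt alpha * log_speed t.
Proof.
move=> t0.
have H : rp^-1 ^+ 2 * (r t - rm) ^+ 2 <= alpha * log_speed t ^+ 2.
  apply: (@energy_ge R alpha rp^-1 0 log_speed (fun t => r t - rm) (derive1 log_speed)
    (fun t => r t * log_speed t)) t0.
  - exact: ltW.
  - by move=> s s0; have [] := wave_speed (negbT (lt_eqF (r_lt s0))).
  - move=> s s0; have [dr_s _ _ _] := wave_speed (negbT (lt_eqF (r_lt s0))).
    have H := is_deriveB dr_s (is_derive_cst rm s 1).
    by rewrite subr0 in H.
  - move=> s s0; have [_ u0 _ le] := wave_speed (negbT (lt_eqF (r_lt s0))).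
    have Dgt0 := dS_gt0 (r_gt0 s) (r_lt s0).
    have /andP[rs1 rs2] := r_range s.
    apply: (@speed_balance R alpha (derive1 S (r s)) _ _ (S (r s))) => //.
    + exact: r_gt0.
    + by rewrite subr_ge0.
    + exact: S_ge_left.
  - by rewrite -(subrr rm); apply: cvgB => //; exact: cvg_cst.
have [_ u0 _ _] := wave_speed (negbT (lt_eqF (r_lt t0))).
have /andP[rt1 rt2] := r_range t.
rewrite -(@ler_pXn2r _ 2)// ?nnegrE ?divr_ge0 ?subr_ge0 ?(ltW rp_gt0)//; last first.
  by rewrite mulr_ge0// sqrtr_ge0.
by rewrite [leLHS]exprMn [leRHS]exprMn sqr_sqrtr ?(ltW alpha_gt0)// [leLHS]mulrC.
Qed.


(** The reflection [s -> - s] moves the end state at [+oo] to [-oo], where [energy_ge] applies at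
    [- t]. It flips the sign of the derivative of [log_speed]; on this side [S'] is negative as
    well, so the product of the two in the speed inequality keeps its sign. *)
Lemma log_speed_ge_right t : 0 < t -> (rp - r t) / rp <= Num.sqrt alpha * log_speed t.
Proof.
move=> t0; have Nt0 : - t < 0 by rewrite oppr_lt0.
have pos (s : R) : s < 0 -> 0 < - s by rewrite oppr_gt0.
have H : rp^-1 ^+ 2 * (rp - r (- - t)) ^+ 2 <= alpha * log_speed (- - t) ^+ 2.
  apply: (@energy_ge R alpha rp^-1 0 (fun s => log_speed (- s)) (fun s => rp - r (- s))
    (fun s => - derive1 log_speed (- s)) (fun s => r (- s) * log_speed (- s))) Nt0.
  - exact: ltW.
  - move=> s /pos s0; have [_ _ du _] := wave_speed (negbT (gt_eqF (r_gt s0))).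
    have H := @is_derive1_comp _ log_speed -%R s _ _ du (is_deriveNid s 1).
    by rewrite mulrN1 in H.
  - move=> s /pos s0; have [dr_s _ _ _] := wave_speed (negbT (gt_eqF (r_gt s0))).
    have H := is_deriveB (is_derive_cst rp s 1)
      (@is_derive1_comp _ r -%R s _ _ dr_s (is_deriveNid s 1)).
    by rewrite sub0r mulrN1 opprK in H.
  - move=> s /pos s0; have [_ u0 _ le] := wave_speed (negbT (gt_eqF (r_gt s0))).
    have Dlt0 := dS_lt0 (r_gt s0).
    have /andP[rs1 rs2] := r_range (- s).
    apply: (@speed_balance R alpha (- derive1 S (r (- s))) _ _ (S (r (- s)))) => //.
    + by rewrite oppr_gt0.
    + exact: r_gt0.
    + by rewrite subr_ge0.
    + exact: S_ge_right (r_gt0 _) rs2.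
    + by rewrite mulrNN.
  - rewrite -(subrr rp); apply: cvgB; first exact: cvg_cst.
    exact: ((cvgy_compNP r (nbhs rp)).1 r_y).
rewrite opprK in H.
have [_ u0 _ _] := wave_speed (negbT (gt_eqF (r_gt t0))).
have /andP[rt1 rt2] := r_range t.
rewrite -(@ler_pXn2r _ 2)// ?nnegrE ?divr_ge0 ?subr_ge0 ?(ltW rp_gt0)//; last first.
  by rewrite mulr_ge0// sqrtr_ge0.
by rewrite [leLHS]exprMn [leRHS]exprMn sqr_sqrtr ?(ltW alpha_gt0)// [leLHS]mulrC.
Qed.

(** The factor [rp] clears the denominator of the speed bounds, and [1 / rm] bounds the [1 / r] in
    the logarithmic derivative, leaving a multiple of [r']. *)
Let K := Num.sqrt alpha * (rp / rm).

Let le_K (d t : R) : 0 <= log_speed t -> d / rp <= Num.sqrt alpha * log_speed t ->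
  d <= K * (r t * log_speed t).
Proof.
move=> u0; rewrite ler_pdivrMr// => /le_trans; apply; rewrite /K.
rewrite (_ : Num.sqrt alpha * (rp / rm) * _ = Num.sqrt alpha * log_speed t * rp * (r t / rm)); last first.
  by field; rewrite gt_eqF.
apply: ler_peMr; first exact: mulr_ge0 (mulr_ge0 (sqrtr_ge0 _) u0) (ltW rp_gt0).
by rewrite ler_pdivlMr// mul1r; have /andP[] := r_range t.
Qed.

Lemma integral_left x : x <= 0 ->
  \int[mu]_(t in `[x, 0]) (r t - rm) <= K * (rs - r x).
Proof.
move=> x0; rewrite -r0 mulrBr.
apply: (@integral_le_increment R (fun t => r t - rm) (fun t => K * r t)
  (fun t => K * (r t * log_speed t))) => //.
- by move=> t; apply: cvgB; [exact: r_continuous|exact: cvg_cst].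
- by move=> t; apply: cvgM; [exact: cvg_cst|exact: r_continuous].
- move=> t /andP[_ t0]; have [d _ _ _] := wave_speed (negbT (lt_eqF (r_lt t0))).
  have H := is_deriveM (is_derive_cst K t 1) d.
  by refine (is_derive_eq H _); rewrite /cst /GRing.scale/= mulr0 addr0.
- move=> t /andP[_ t0]; have [_ u0 _ _] := wave_speed (negbT (lt_eqF (r_lt t0))).
  by apply: le_K => //; exact: log_speed_ge_left.
Qed.

Lemma integral_right y : 0 <= y ->
  \int[mu]_(t in `[0, y]) (rp - r t) <= K * (r y - rs).
Proof.
move=> y0; rewrite -r0 mulrBr.
apply: (@integral_le_increment R (fun t => rp - r t) (fun t => K * r t)
  (fun t => K * (r t * log_speed t))) => //.
- by move=> t; apply: cvgB; [exact: cvg_cst|exact: r_continuous].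
- by move=> t; apply: cvgM; [exact: cvg_cst|exact: r_continuous].
- move=> t /andP[t0 _]; have [d _ _ _] := wave_speed (negbT (gt_eqF (r_gt t0))).
  have H := is_deriveM (is_derive_cst K t 1) d.
  by refine (is_derive_eq H _); rewrite /cst /GRing.scale/= mulr0 addr0.
- move=> t /andP[t0 _]; have [_ u0 _ _] := wave_speed (negbT (gt_eqF (r_gt t0))).
  by apply: le_K => //; exact: log_speed_ge_right.
Qed.

End Wave.
End Flux.

(** * From L^1 to L^p rates *)

Section Rates.
Context {R : realType}.
Notation mu := (@lebesgue_measure R).
Implicit Types (a b x y t : R).

Lemma measurable_step a b : measurable_fun setT (step a b).
Proof.
rewrite (_ : step a b = fun t => b + (a - b) * \1_(`]-oo, 0[%classic) t).
  apply: measurable_funD => //; apply: measurable_funM => //.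
apply/funext => t; rewrite /step indicE mem_setE in_itv/=.
by case: ifP; rewrite ?mulr1 ?mulr0 ?addr0// subrKC.
Qed.

Lemma le_integral_itv_EFin (h : R -> R) (C x y : R) : continuous h ->
  \int[mu]_(t in `[x, y]) h t <= C -> (\int[mu]_(t in `[x, y]) (h t)%:E <= C%:E)%E.
Proof.
move=> ch; rewrite -lee_fin /Rintegral fineK//.
apply: integrable_fin_num => //; apply: continuous_compact_integrable.
  exact: segment_compact.
exact: continuous_subspaceT.
Qed.

Lemma integral_step_dist (r : R -> R) a b (C1 C2 : R) : continuous r ->
  (forall t, a <= r t <= b) ->
  (forall x, x <= 0 -> \int[mu]_(t in `[x, 0]) (r t - a) <= C1) ->
  (forall y, 0 <= y -> \int[mu]_(t in `[0, y]) (b - r t) <= C2) ->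
  (\int[mu]_t `|r t - step a b t|%:E <= (C1 + C2)%:E)%E.
Proof.
move=> cr rab h1 h2.
have mr : measurable_fun setT r by exact: continuous_measurable_fun.
have md : measurable_fun setT (fun t => `|r t - step a b t|%:E).
  apply/measurable_EFinP; apply: measurableT_comp => //.
  by apply: measurable_funB => //; exact: measurable_step.
(* The bounds on bounded windows do not depend on [n], so monotone convergence carries them to the
   line. *)
pose F n : set R := `[- n%:R, n%:R]%classic.
have FT : \bigcup_n F n = setT.
  rewrite -subTset => t _; exists (Num.bound `|t|) => //.
  by rewrite /F/= in_itv/= -ler_norml ltW// archi_boundP.
have mF n : measurable (F n) by exact: measurable_itv.
rewrite -FT; apply: (@cvge_le _ _ _ _ (fun n => \int[mu]_(t in F n) `|r t - step a b t|%:E)%E); last first.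
  apply: ge0_nondecreasing_set_cvg_integral => //.
  - apply/nondecreasing_seqP => n; rewrite subsetEset; apply: subset_itv; rewrite bnd_simp.
      by rewrite lerN2 ler_nat.
    by rewrite ler_nat.
  - by move=> n; exact: measurable_funTS.
apply: nearW => n.
have n0 : (0 : R) <= n%:R by [].
(* The point 0 goes to the right-hand piece, where [step a b] takes the value [b]. *)
rewrite /F (@itv_bndbnd_setU _ _ _ (BLeft 0)) ?bnd_simp ?oppr_le0//.
rewrite ge0_integral_setU//=; last 2 first.
- exact: measurable_funTS.
- by apply/disj_setPLR => t /=; rewrite !in_itv/= => /andP[_ t0]; rewrite leNgt t0.
rewrite EFinD; apply: leeD.
- have -> : (\int[mu]_(t in `[(- n%:R)%R, 0%R[) `|r t - step a b t|%R%:E =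
    \int[mu]_(t in `[(- n%:R)%R, 0%R[) (r t - a)%R%:E)%E.
    apply: eq_integral.
    move=> t; rewrite inE/= in_itv/= => /andP[_ t0]; rewrite /step t0 ger0_norm//.
    by rewrite subr_ge0; case/andP: (rab t).
  apply: (@le_trans _ _ (\int[mu]_(t in `[(- n%:R)%R, 0%R]) (r t - a)%R%:E)%E).
    apply: ge0_subset_integral => //=.
    - by apply/measurable_EFinP; apply: measurable_funB => //; exact: measurable_funTS.
    - by move=> t _; rewrite lee_fin subr_ge0; case/andP: (rab t).
    - exact: subset_itv_co_cc.
  apply: le_integral_itv_EFin; last by apply: h1; rewrite oppr_le0.
  by move=> t; apply: cvgB; [exact: cr|exact: cvg_cst].
- have -> : (\int[mu]_(t in `[0%R, n%:R%R]) `|r t - step a b t|%R%:E =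
    \int[mu]_(t in `[0%R, n%:R%R]) (b - r t)%R%:E)%E.
    apply: eq_integral.
    move=> t; rewrite inE/= in_itv/= => /andP[t0 _]; rewrite /step ltNge t0/= distrC ger0_norm//.
    by rewrite subr_ge0; case/andP: (rab t).
  apply: le_integral_itv_EFin; last exact: h2.
  by move=> t; apply: cvgB; [exact: cvg_cst|exact: cr].
exact: eventually_filter.
Qed.

(** Interpolation between the integral and the supremum of [d]: pointwise,
    [|f|^p <= L^p d^p <= L^p D^(p-1) d]. *)
Lemma Lnorm_rate (p C D L : R) (f d : R -> R) : 1 <= p -> 0 <= C -> 0 <= D -> 0 <= L ->
  measurable_fun setT f -> measurable_fun setT d ->
  (forall t, `|f t| <= L * d t) -> (forall t, 0 <= d t <= D) ->
  (\int[mu]_t (d t)%:E <= C%:E)%E ->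
  (Lnorm mu p%:E (EFin \o f) <= ((L `^ p * D `^ (p - 1) * C) `^ p^-1)%:E)%E.
Proof.
move=> p1 C0 D0 L0 mf md fd dD idC; have p0 : 0 < p by lra.
have d0 t : 0 <= d t by case/andP: (dD t).
have M0 : 0 <= L `^ p * D `^ (p - 1) by rewrite mulr_ge0// powR_ge0.
rewrite unlock /Lnorm -poweR_EFin.
apply: gt0_ler_poweR; first by rewrite invr_ge0 ltW.
- by rewrite in_itv/= leey andbT; apply: integral_ge0 => t _; rewrite lee_fin powR_ge0.
- by rewrite in_itv/= leey andbT lee_fin mulr_ge0.
rewrite EFinM; apply: (@le_trans _ _ (\int[mu]_t ((L `^ p * D `^ (p - 1))%:E * (d t)%:E))%E).
  apply: ge0_le_integral => //.
  - by move=> t _; exact: poweR_ge0.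
  - apply: (measurableT_comp (measurable_poweR _)).
    by apply/measurable_EFinP; exact: measurableT_comp.
  - by apply/measurable_EFinP; exact: measurable_funM.
  - move=> t _; rewrite /= lee_fin.
    apply: (@le_trans _ _ ((L * d t) `^ p)).
      by apply: ge0_ler_powR; rewrite ?nnegrE ?mulr_ge0 ?(ltW p0).
    rewrite powRM// -mulrA ler_wpM2l ?powR_ge0//.
    rewrite -mulr_powRB1// mulrC ler_wpM2r//.
    by apply: ge0_ler_powR; rewrite ?nnegrE ?subr_ge0//; case/andP: (dD t).
rewrite ge0_integralZl//; first by apply: lee_wpmul2l; rewrite ?lee_fin.
- by apply/measurable_EFinP.
- by move=> t _; rewrite lee_fin.
Qed.

Lemma C1_lipschitz (h dh : R -> R) a b : a <= b ->
  (forall x, a <= x <= b -> is_derive x 1 h (dh x)) ->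
  (forall x, a <= x <= b -> {for x, continuous dh}) ->
  exists2 L : R, 0 <= L & forall x y, a <= x <= b -> a <= y <= b -> `|h x - h y| <= L * `|x - y|.
Proof.
move=> ab hd hc.
have [|c _ cmax] := @EVT_max R (fun x => `|dh x|) a b ab.
  apply: continuous_in_subspaceT => x; rewrite inE/= in_itv/= => xab.
  by apply: (@continuous_comp _ _ _ dh); [exact: hc|exact: norm_continuous].
exists `|dh c|; first by [].
have lip x y : x < y -> a <= x <= b -> a <= y <= b -> `|h x - h y| <= `|dh c| * `|x - y|.
  move=> xy /andP[ax xb] /andP[ay yb].
  have [|z /andP[xz zy] E] := @MVT_is_derive R h dh x y xy.
    by move=> z /andP[xz zy]; apply: hd; rewrite (le_trans ax) ?(le_trans zy).
  rewrite distrC E normrM (distrC x) ler_wpM2r//; apply: cmax.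
  by rewrite in_itv/= (le_trans ax) ?(le_trans _ yb) ?ltW.
move=> x y xab yab; have [xy|xy|->] := ltgtP x y.
- exact: lip.
- by rewrite distrC (distrC x); exact: lip.
- by rewrite !subrr normr0 mulr0.
Qed.

(** The limit profile is [h] composed with [step a b], so the Lipschitz bound of [h] on [[a, b]]
    compares it with [h] of the wave. The exponent arises from
    [(sqrt alpha)^(1/p) = alpha^(1/(2p))]. *)
Lemma Lp_rate_lipschitz (p a b C : R) (r_ : R -> R -> R) (h dh : R -> R) :
  1 <= p -> a < b -> 0 <= C ->
  (forall x, a <= x <= b -> is_derive x 1 h (dh x)) ->
  (forall x, a <= x <= b -> {for x, continuous dh}) ->
  (forall alpha, 0 < alpha -> [/\ continuous (r_ alpha), forall t, a <= r_ alpha t <= b &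
    (\int[mu]_t `|r_ alpha t - step a b t|%:E <= (Num.sqrt alpha * C)%:E)%E]) ->
  Lp_rate p (fun alpha t => h (r_ alpha t)) (step (h a) (h b)).
Proof.
move=> p1 ab C0 hd hc hr; have [L L0 hL] := C1_lipschitz (ltW ab) hd hc.
exists ((L `^ p * (b - a) `^ (p - 1) * C) `^ p^-1) => alpha alpha0.
have [cr rab irs] := hr alpha alpha0.
have mr : measurable_fun setT (r_ alpha) by exact: continuous_measurable_fun.
have sab t : a <= step a b t <= b by rewrite /step; case: ifP => _; rewrite lexx ltW.
have hs t : step (h a) (h b) t = h (step a b t) by rewrite /step; case: ifP.
have M0 : 0 <= L `^ p * (b - a) `^ (p - 1) * C by rewrite !mulr_ge0// powR_ge0.
have -> : (L `^ p * (b - a) `^ (p - 1) * C) `^ p^-1 * alpha `^ (2 * p)^-1 =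
    (L `^ p * (b - a) `^ (p - 1) * (Num.sqrt alpha * C)) `^ p^-1.
  rewrite invfM powRrM powR12_sqrt ?(ltW alpha0)// -powRM ?sqrtr_ge0//.
  by congr (_ `^ _); ring.
apply: (@Lnorm_rate p _ (b - a) L _ (fun t => `|r_ alpha t - step a b t|)) => //.
- by rewrite mulr_ge0 ?sqrtr_ge0.
- by rewrite subr_ge0 ltW.
- apply: measurable_funB; last exact: measurable_step.
  apply: continuous_measurable_fun => t; apply: continuous_comp; first exact: cr.
  exact: is_derive_continuous (hd _ (rab t)).
- apply: measurableT_comp => //; apply: measurable_funB => //; exact: measurable_step.
- by move=> t; rewrite hs; exact: hL.
- move=> t; rewrite normr_ge0/=.
  by have /andP[? ?] := rab t; have /andP[? ?] := sab t; rewrite ler_norml; apply/andP; split; lra.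
Qed.
End Rates.

(** On the two half-lines [r] increases by at most [rs - rm] and [rp - rs]; multiplied by the common
    factor these add up to the full jump [rp - rm]. *)
Lemma igr_wave_dist (R : realType) (m rm rp rs : R) (S S2 : R -> R) :
  0 < rm -> rm < rs -> rs < rp -> m != 0 ->
  (forall x : R, 0 < x -> is_derive x 1 S (derive1 S x)) ->
  (forall x : R, 0 < x -> is_derive x 1 (derive1 S) (S2 x)) ->
  (forall x : R, 0 < x -> S2 x <= - (2 * m ^+ 2 / x ^+ 3)) ->
  S rm = 0 -> S rp = 0 -> derive1 S rs = 0 ->
  forall alpha r, 0 < alpha -> igr_wave m rm rp rs S alpha r ->
  [/\ continuous r, forall t, rm <= r t <= rp &
    (\int[lebesgue_measure]_t `|r t - step rm rp t|%:E <=
      (Num.sqrt alpha * (rp / rm * (rp - rm)))%:E)%E].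
Proof.
move=> rm0 rms rsp m0 dS ddS S2le Srm Srp dSrs alpha r a0.
move=> [mono rng [rNy ry] r0 [dr [r2 dr2 rdr req]]].
have rng' t : rm <= r t <= rp by have := rng t; rewrite in_itv.
have cr : continuous r by exact: r_continuous mono r2 dr2 rdr.
have K0 : 0 <= Num.sqrt alpha * (rp / rm).
  by rewrite mulr_ge0 ?sqrtr_ge0// divr_ge0 ?ltW// (lt_trans rm0)// (lt_trans rms).
split => //.
have -> : Num.sqrt alpha * (rp / rm * (rp - rm)) =
  Num.sqrt alpha * (rp / rm) * (rs - rm) + Num.sqrt alpha * (rp / rm) * (rp - rs) by ring.
apply: integral_step_dist => //.
- move=> x x0.
  apply: le_trans (integral_left rm0 rms rsp m0 dS ddS S2le Srm dSrs a0 mono rng' rNy r2 dr2 rdr req r0 x0) _.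
  by rewrite ler_wpM2l// lerD2l lerN2; case/andP: (rng' x).
- move=> y y0.
  apply: le_trans (integral_right rm0 rms rsp m0 dS ddS S2le Srm Srp dSrs a0 mono rng' ry r2 dr2 rdr req r0 y0) _.
  by rewrite ler_wpM2l// lerD2r; case/andP: (rng' y).
Qed.

(** * The Rankine-Hugoniot curve *)

(** Identifies the end states as points of the reduced curve, so that the limits of velocity and
    energy are values of functions of the density, and the limit of [S] is zero. *)
Lemma rankine_hugoniot_energy (R : realType) (pt : R -> R -> R) (c m q k rho u E : R) :
  m != 0 -> 0 < rho -> rankine_hugoniot pt c m q k rho u E ->
  [/\ u = c + m / rho, energy c m q k rho = E / rho - u ^+ 2 / 2 &
    calS pt c m q k rho = 0].
Proof.
move=> m0 rho0 [h1 h2 h3].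
have rho_neq0 : rho != 0 by rewrite gt_eqF.
have hu : u = c + m / rho by rewrite -h1; field.
set e := E / rho - u ^+ 2 / 2 in h2 h3.
(* The energy relation, with the pressure eliminated by the momentum relation and then multiplied by
   [rho]. *)
have hE : E * m = rho * (k - (q - m * u) * u).
  by rewrite -h2 -h3 -h1; ring.
have he : energy c m q k rho = e.
  rewrite /energy /e (_ : E = rho * (k - (q - m * u) * u) / m); last by rewrite -hE mulfK.
  by rewrite hu; field; rewrite m0 rho_neq0.
split => //; rewrite /calS /reduced_pressure he -h2 hu.
by field.
Qed.

Lemma is_derive_inv (R : realType) (x : R) : 0 < x -> is_derive x 1 (fun y : R => y^-1) (- (x^-1 * x^-1)).
Proof.
move=> x0; have xn0 : x != 0 by rewrite gt_eqF.
have H := @is_deriveV R id x 1 1 xn0 (is_derive_id x 1).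
by refine (is_derive_eq H _); rewrite /GRing.scale/= mulr1 expr2 invfM.
Qed.

Lemma is_derive_calS (R : realType) (pt : R -> R -> R) (c m q k x : R) :
  0 < x -> derivable (reduced_pressure pt c m q k) x 1 ->
  is_derive x 1 (calS pt c m q k)
    (m ^+ 2 * (x^-1 * x^-1) - derive1 (reduced_pressure pt c m q k) x).
Proof.
move=> x0 dp.
have H := is_deriveB (is_deriveB (is_derive_cst (q - m * c) x 1)
  (is_deriveM (is_derive_cst (m ^+ 2) x 1) (is_derive_inv x0))) (derivable_is_derive dp).
refine (is_derive_eq H _); rewrite /cst /GRing.scale/=; ring.
Qed.

Lemma is_derive_derive1_calS (R : realType) (pt : R -> R -> R) (c m q k x : R) :
  C2_on1 [set r | 0 < r] (reduced_pressure pt c m q k) -> 0 < x ->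
  is_derive x 1 (derive1 (calS pt c m q k))
    (- (2 * m ^+ 2 / x ^+ 3) - derive1n 2 (reduced_pressure pt c m q k) x).
Proof.
move=> pC2 x0; have [_ ddp _] := pC2 x x0.
have dV := is_derive_inv x0.
have H := is_deriveB (is_deriveM (is_derive_cst (m ^+ 2) x 1) (is_deriveM dV dV))
  (derivable_is_derive ddp).
(* The formula for [S'] holds only at positive densities, which suffices on a neighborhood of
   [x]. *)
apply: (@near_eq_is_derive R _ _
    (fun y : R => m ^+ 2 * (y^-1 * y^-1) - derive1 (reduced_pressure pt c m q k) y : R)).
  near=> y; have y0 : 0 < y by near: y; exact: lt_nbhsr.
  by have [dp _ _] := pC2 y y0; rewrite (is_derive_derive1 (is_derive_calS y0 dp)).
refine (is_derive_eq H _); rewrite /cst /GRing.scale/=. 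
by field; rewrite gt_eqF.
Unshelve. all: by end_near. Qed.

Theorem theorem5p6 (R : realType) (pt : R -> R -> R) (c m q k : R)
    (rm rp um up Em Ep rs : R)
    (e := energy c m q k)
    (p := reduced_pressure pt c m q k)
    (S := calS pt c m q k)
    (pt_C2 : C2_on [set x | 0 < x.1] pt)
    (m_neq0 : m != 0)
    (rm_gt0 : 0 < rm) (rp_gt0 : 0 < rp)
    (RHm : rankine_hugoniot pt c m q k rm um Em)
    (RHp : rankine_hugoniot pt c m q k rp up Ep)
    (rm_lt_rp : rm < rp)
    (dpm_ge0 : 0 <= derive1 p rm) (dpp_ge0 : 0 <= derive1 p rp)
    (Lax : up - Num.sqrt (derive1 p rp) < c < um - Num.sqrt (derive1 p rm))
    (p_C2 : C2_on1 [set r | 0 < r] p)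
    (convexity : convexity_A pt c m q k rm rp \/ convexity_B pt c m q k rm rp)
    (ddp_ge0 : forall r, 0 < r -> 0 <= derive1n 2 p r)
    (rs_in : rm < rs < rp)
    (rs_sonic : derive1 S rs = 0)
    (rs_unique : forall r, 0 < r -> derive1 S r = 0 -> r = rs)
    (ddp_lip : exists2 d : R, 0 < d & [lipschitz derive1n 2 p x | x in ball rs d])
    (mu : R) (mu_ge1 : 1 <= mu)
    (r_ : R -> R -> R)
    (r_wave : forall alpha, 0 < alpha -> igr_wave m rm rp rs S alpha (r_ alpha)) :
  [/\ Lp_rate mu r_ (step rm rp),
      Lp_rate mu (fun alpha xi => c + m / r_ alpha xi) (step um up),
      Lp_rate mu (fun alpha xi => e (r_ alpha xi))
        (step (Em / rm - um ^+ 2 / 2) (Ep / rp - up ^+ 2 / 2)) &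
      Lp_rate mu (fun alpha xi => S (r_ alpha xi)) (fun=> 0)].
Proof.
have [hum hem hSm] := rankine_hugoniot_energy m_neq0 rm_gt0 RHm.
have [hup hep hSp] := rankine_hugoniot_energy m_neq0 rp_gt0 RHp.
have /andP[rm_rs rs_rp] := rs_in.
have dS (x : R) : 0 < x -> is_derive x 1 S (derive1 S x).
  move=> x0; have [dp _ _] := p_C2 x x0.
  by rewrite (is_derive_derive1 (is_derive_calS x0 dp)); exact: is_derive_calS.
have ddS (x : R) (x0 : 0 < x) := is_derive_derive1_calS p_C2 x0.
have ddS_le (x : R) : 0 < x -> - (2 * m ^+ 2 / x ^+ 3) - derive1n 2 p x <= - (2 * m ^+ 2 / x ^+ 3).
  by move=> x0; rewrite gerDl oppr_le0 ddp_ge0.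
have dist alpha (a0 : 0 < alpha) := igr_wave_dist rm_gt0 rm_rs rs_rp m_neq0 dS ddS ddS_le
  hSm hSp rs_sonic a0 (r_wave alpha a0).
have C0 : 0 <= rp / rm * (rp - rm).
  by apply: mulr_ge0; [apply: divr_ge0; exact: ltW|rewrite subr_ge0; exact: ltW].
have pos (x : R) : rm <= x <= rp -> 0 < x by case/andP => h _; exact: lt_le_trans h.
have V_cont (x : R) : 0 < x -> {for x, continuous (fun y : R => y^-1)}.
  by move=> x0; apply: cvgV; [rewrite gt_eqF|exact: cvg_id].
split.
- apply: (Lp_rate_lipschitz (h := id) (dh := cst 1) mu_ge1 rm_lt_rp C0 _ _ dist).
  by move=> x _; exact: cvg_cst.
- rewrite hum hup.
  apply: (Lp_rate_lipschitz (h := fun x => c + m / x)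
    (dh := fun x => m * - (x^-1 * x^-1)) mu_ge1 rm_lt_rp C0 _ _ dist) => x /pos x0.
    have H := is_deriveD (is_derive_cst c x 1) (is_deriveM (is_derive_cst m x 1) (is_derive_inv x0)).
    by refine (is_derive_eq H _); rewrite /cst /GRing.scale/= mulr0 addr0 add0r.
  apply: cvgM; first exact: cvg_cst.
  by apply: cvgN; apply: cvgM; exact: V_cont.
- rewrite -hem -hep.
  apply: (Lp_rate_lipschitz (h := e)
    (dh := fun x => (m * c - q) * - (x^-1 * x^-1) + m ^+ 2 * - (x^-1 * (x^-1 * x^-1)))
    mu_ge1 rm_lt_rp C0 _ _ dist) => x /pos x0.
    have dV := is_derive_inv x0.
    have H := is_deriveD (is_deriveD (is_derive_cst ((k - q * c + m / 2 * c ^+ 2) / m) x 1)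
      (is_deriveM (is_derive_cst (m * c - q) x 1) dV))
      (is_deriveM (is_derive_cst (m ^+ 2 / 2) x 1) (is_deriveM dV dV)).
    (* Written as a combination of products of the inverse function, so that the derivative
       assembled in [H] applies. *)
    have -> : e = cst ((k - q * c + m / 2 * c ^+ 2) / m) +
        cst (m * c - q) * (fun y : R => y^-1) +
        cst (m ^+ 2 / 2) * ((fun y : R => y^-1) * (fun y : R => y^-1)).
      apply/funext => y; have y2 : (y ^+ 2)^-1 = y^-1 * y^-1 by rewrite expr2 invfM.
      rewrite /e /energy invfM y2 !addrfctE !mulrfctE /cst; ring.
    refine (is_derive_eq H _); rewrite /cst /GRing.scale/=.
    by field; rewrite gt_eqF.
  apply: cvgD; (apply: cvgM; first exact: cvg_cst); apply: cvgN; apply: cvgM; try exact: V_cont.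
  by apply: cvgM; exact: V_cont.
(* Since [S] vanishes at both end states, the zero limit is itself a step profile, and the same
   transfer from the density applies. *)
- have -> : (fun=> 0) = step (S rm) (S rp) by apply/funext => t; rewrite /step /S hSm hSp; case: ifP.
  apply: (Lp_rate_lipschitz (h := S) (dh := derive1 S) mu_ge1 rm_lt_rp C0 _ _ dist) => x /pos x0.
    exact: dS.
  exact: is_derive_continuous (ddS x x0).
Qed.
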